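(* Suppose $V$ is a conceptual theory and that the interpretations $K:U\to V$ and $M:V\to U$ form a bi-interpretation of $U$ and $V$, where $K$ and $M$ are both one-dimensional and identity-preserving. Then $U$ and $V$ are synonymous.
   Context: Theories are one-sorted first-order theories in a relational signature, with identity as a logical constant. An $m$-dimensional interpretation $K:U\to V$ of a one-sorted theory is given by a $V$-formula $\delta_K(\vec x)$ with $\vec x$ of length $m$ and, for each $n$-ary predicate $P$ of $U$ (including identity, translated to $=_K$), a $V$-formula $P_K$; the translation $A^K$ commutes with connectives and relativizes quantifiers to $\delta_K$; it is required that $U\vdash A$ implies $V\vdash A^K$ for all $U$-sentences $A$. Composition $M\circ K:U\to W$ (for $K:U\to V$, $M:V\to W$) translates first by $K$ then by $M$; ${\sf id}_T$ is the identity interpretation. A one-dimensional interpretation is identity-preserving if it translates $x=y$ as $x=y$. An i-isomorphism between $K,K':U\to V$ is a $V$-formula $F$ which $V$ proves to be an isomorphism between the internal models given by $K$ and $K'$ (respecting $=_K,=_{K'}$, total, onto, functional and injective modulo these, preserving and reflecting all predicates). $K,M$ form a bi-interpretation iff $M\circ K$ is i-isomorphic to ${\sf id}_U$ and $K\circ M$ is i-isomorphic to ${\sf id}_V$. $U$ and $V$ are synonymous iff there are $K:U\to V$, $M:V\to U$ such that $U$ proves $M\circ K$ coincides with ${\sf id}_U$ (same dimension, equivalent domains and equivalent translations of every predicate including identity) and $V$ proves $K\circ M$ coincides with ${\sf id}_V$. The theory $\mathsf{ac}$ is two-sorted, with a sort $\mathfrak o$ of objects and a sort $\mathfrak c$ of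 classes, identity on each sort and membership $\in$ of type $\mathfrak o\mathfrak c$, with axioms: there is a class with no members; for every class $Y$ and object $y$ there is a class $X$ with $\forall x\,(x\in X\leftrightarrow(x\in Y\vee x=y))$; two classes with the same members are equal. An interpretation of $\mathsf{ac}$ in a one-sorted theory $T$ assigns to each sort a dimension and a domain formula, and to each predicate (including identity on each sort) a $T$-formula on tuples of appropriate lengths, relativizing quantifiers of each sort to its domain, such that $T$ proves the translation of every theorem of $\mathsf{ac}$; it is $\mathfrak o$-direct if sort $\mathfrak o$ is one-dimensional with domain $x=x$ and identity on $\mathfrak o$ is translated as identity. $T$ is conceptual iff there is an $\mathfrak o$-direct interpretation of $\mathsf{ac}$ in $T$. *)

(* Defs.v *)
From HB Require Import structures.
From mathcomp Require Import all_boot.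
Set Implicit Arguments.
Unset Strict Implicit.
Unset Printing Implicit Defensive.

(** * Many-sorted relational first-order logic with identity *)

Record msig := MSig {
  sort_of : eqType;
  preds : Type;
  ar : preds -> nat;
  srt : forall P : preds, 'I_(ar P) -> sort_of
}.

(* De Bruijn syntax, with a separate index space for each sort: the sort of a
   variable is determined by the position in which it occurs, and [fAll s] binds
   index 0 of sort [s] while leaving the indices of the other sorts alone. *)
Inductive form (S : msig) : Type :=
| fFalse
| fEq (s : sort_of S) (x y : nat)
| fRel (P : preds S) (a : (ar P).-tuple nat)
| fImp (A B : form S)
| fAll (s : sort_of S) (A : form S).
Arguments fFalse {S}.
Arguments fEq {S} s x y.
Arguments fRel {S} P a.

Section Logic.
Variable S : msig.
Implicit Types (A B : form S) (s : sort_of S) (r : sort_of S -> nat -> nat).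

Definition fNot A := fImp A fFalse.
Definition fTrue : form S := fNot fFalse.
Definition fAnd A B := fNot (fImp A (fNot B)).
Definition fOr A B := fImp (fNot A) B.
Definition fIff A B := fAnd (fImp A B) (fImp B A).
Definition fEx s A := fNot (fAll s (fNot A)).
Definition fConj (l : seq (form S)) := foldr fAnd fTrue l.
Definition fAlls s n A := iter n (fAll s) A.
Definition fExs s n A := iter n (fEx s) A.

Definition shift s : sort_of S -> nat -> nat := fun s' n => (s' == s) + n.

Definition inst s (x : nat) : sort_of S -> nat -> nat := fun s' n =>
  if s' == s then (if n is m.+1 then m else x) else n.

Definition up_ren s r : sort_of S -> nat -> nat := fun s' n =>
  if s' == s then (if n is m.+1 then (r s' m).+1 else 0) else r s' n.

Fixpoint ren r A : form S :=
  match A with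
  | fFalse => fFalse
  | fEq s x y => fEq s (r s x) (r s y)
  | fRel P a => fRel P [tuple r (srt i) (tnth a i) | i < ar P]
  | fImp A B => fImp (ren r A) (ren r B)
  | fAll s A => fAll s (ren (up_ren s r) A)
  end.

(* The free variables of sort [s] in [A] have index < [n s]. *)
Fixpoint fv_below (n : sort_of S -> nat) A : bool :=
  match A with
  | fFalse => true
  | fEq s x y => (x < n s) && (y < n s)
  | fRel P a => [forall i : 'I_(ar P), tnth a i < n (srt i)]
  | fImp A B => fv_below n A && fv_below n B
  | fAll s A => fv_below (fun s' => (s' == s) + n s') A
  end.

Definition sentence A : bool := fv_below (fun=> 0) A.

(* Classical natural deduction. *)
Inductive prv (G : form S -> Prop) : form S -> Prop :=
| prv_ax A : G A -> prv G A
| prv_impI A B : prv (fun C => C = A \/ G C) B -> prv G (fImp A B)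
| prv_impE A B : prv G (fImp A B) -> prv G A -> prv G B
| prv_raa A : prv (fun C => C = fNot A \/ G C) fFalse -> prv G A
| prv_allI s A :
    prv (fun C => exists2 B, G B & C = ren (shift s) B) A -> prv G (fAll s A)
| prv_allE s A x : prv G (fAll s A) -> prv G (ren (inst s x) A)
| prv_eqI s x : prv G (fEq s x x)
| prv_eqE s x y A :
    prv G (fEq s x y) -> prv G (ren (inst s x) A) -> prv G (ren (inst s y) A).

End Logic.
Arguments fTrue {S}.

Record theory (S : msig) := Theory {
  axioms : form S -> Prop;
  axioms_sentence : forall A, axioms A -> sentence A
}.

(* As axioms are sentences, proving an open formula amounts to proving its
   universal closure; open formulas are used in this way below. *)
Definition proves (S : msig) (T : theory S) (A : form S) : Prop :=
  prv (axioms T) A.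

(** * One-sorted signatures *)

Record rsig := RSig { rpred : Type; rar : rpred -> nat }.

Definition one_sorted (S : rsig) : msig :=
  @MSig unit (rpred S) (@rar S) (fun _ _ => tt).
Coercion one_sorted : rsig >-> msig.

(* [appf A xs] is A(xs): the variables 0, 1, ..., size xs - 1 of [A] are replaced
   by the variables listed in [xs]. *)
Definition appf (S : rsig) (A : form S) (xs : seq nat) : form S :=
  ren (fun _ i => nth 0 xs i) A.

(** * Interpretations in one-sorted theories *)

(* In [tdom s] the variables 0 .. d-1 stand for the tuple, where d = tdim s;
   in [teq s] and [trel P] the tuples for the successive arguments are
   concatenated. *)
Record translation (S : msig) (S' : rsig) := Translation {
  tdim : sort_of S -> nat;
  tdom : sort_of S -> form S';
  teq : sort_of S -> form S';
  trel : preds S -> form S'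
}.

Definition well_scoped (S : msig) (S' : rsig) (t : translation S S') : Prop :=
  [/\ forall s, fv_below (fun=> tdim t s) (tdom t s),
      forall s, fv_below (fun=> tdim t s + tdim t s) (teq t s)
    & forall P : preds S,
        fv_below (fun=> \sum_(i < ar P) tdim t (srt i)) (trel t P)].

Section Translate.
Variables (S : msig) (S' : rsig) (t : translation S S').

(* An environment maps each variable to the tuple of variables it becomes. *)
Definition up_env (s : sort_of S) (e : sort_of S -> nat -> seq nat) :
    sort_of S -> nat -> seq nat := fun s' n =>
  if s' == s then
    (if n is m.+1 then map (addn (tdim t s)) (e s' m) else iota 0 (tdim t s))
  else map (addn (tdim t s)) (e s' n).

Fixpoint translate_in (e : sort_of S -> nat -> seq nat) (A : form S) : form S' :=
  match A with
  | fFalse => fFalse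
  | fEq s x y => appf (teq t s) (e s x ++ e s y)
  | fRel P a =>
      appf (trel t P) (flatten [seq e (srt i) (tnth a i) | i <- enum 'I_(ar P)])
  | fImp A B => fImp (translate_in e A) (translate_in e B)
  | fAll s A => @fAlls S' tt (tdim t s)
      (fImp (tdom t s) (translate_in (up_env s e) A))
  end.

(* Variable n becomes the n-th block of d variables. For one-sorted [S] distinct
   variables get disjoint blocks; for sentences the environment is irrelevant. *)
Definition translate : form S -> form S' :=
  translate_in (fun s n => iota (n * tdim t s) (tdim t s)).

End Translate.

Record interp (S : msig) (S' : rsig) (U : theory S) (V : theory S') := Interp {
  itrans :> translation S S';
  interp_scoped : well_scoped itrans;
  interp_sound : forall A, sentence A -> proves U A ->
    proves V (translate itrans A)
}.

Section Operations.
Variables (S S' : rsig).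

Definition dim (t : translation S S') : nat := @tdim S S' t tt.
Definition dom (t : translation S S') : form S' := @tdom S S' t tt.
Definition eqf (t : translation S S') : form S' := @teq S S' t tt.

Definition id_trans : translation S S :=
  @Translation S S (fun=> 1) (fun=> @fEq S tt 0 0) (fun=> @fEq S tt 0 1)
    (fun P => @fRel S P [tuple i : nat | i < rar P]).

(* [comp_trans M K] translates first by [K], then by [M]. *)
Definition comp_trans (S'' : rsig) (M : translation S' S'')
    (K : translation S S') : translation S S'' :=
  let m := @tdim S' S'' M tt in
  @Translation S S'' (fun=> dim K * m)
    (fun=> fAnd
       (fConj [seq appf (@tdom S' S'' M tt) (iota (i * m) m) | i <- iota 0 (dim K)])
       (translate M (dom K)))
    (fun=> translate M (eqf K))
    (fun P => translate M (@trel S S' K P)).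

Definition identity_preserving (t : translation S S') : Prop :=
  eqf t = @fEq S' tt 0 1.

(* [T] proves that [F] is an isomorphism between the internal models given by
   [K] and [K']. The tuples x, y, ... range over all tuples of variables. *)
Definition i_isomorphism (T : theory S') (K K' : translation S S')
    (F : form S') : Prop :=
  let d := dim K in let d' := dim K' in
  let Fm (x : d.-tuple nat) (y : d'.-tuple nat) := appf F (x ++ y) in
  fv_below (fun=> d + d') F /\
  [/\ forall (x : d.-tuple nat) (y : d'.-tuple nat),
        proves T (fImp (Fm x y) (fAnd (appf (dom K) x) (appf (dom K') y))),
      forall (x x' : d.-tuple nat) (y y' : d'.-tuple nat),
        proves T (fImp (fConj
          [:: appf (dom K) x; appf (dom K) x'; appf (dom K') y; appf (dom K') y';
              appf (eqf K) (x ++ x'); appf (eqf K') (y ++ y'); Fm x y])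
          (Fm x' y')),
      (* total *)
      forall x : d.-tuple nat,
        proves T (fImp (appf (dom K) x)
          (@fExs S' tt d' (fAnd (appf (dom K') (iota 0 d'))
                    (appf F (map (addn d') x ++ iota 0 d'))))),
      (* onto *)
      forall y : d'.-tuple nat,
        proves T (fImp (appf (dom K') y)
          (@fExs S' tt d (fAnd (appf (dom K) (iota 0 d))
                    (appf F (iota 0 d ++ map (addn d) y)))))
    &
      (* functional and injective *)
      (forall (x x' : d.-tuple nat) (y y' : d'.-tuple nat),
        proves T (fImp (fAnd (Fm x y) (Fm x' y'))
          (fIff (appf (eqf K) (x ++ x')) (appf (eqf K') (y ++ y'))))) /\
      (forall (P : rpred S) (x : 'I_(rar P) -> d.-tuple nat)
              (y : 'I_(rar P) -> d'.-tuple nat),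
        proves T (fImp (fConj [seq Fm (x i) (y i) | i <- enum 'I_(rar P)])
          (fIff
            (appf (@trel S S' K P) (flatten [seq val (x i) | i <- enum 'I_(rar P)]))
            (appf (@trel S S' K' P)
                 (flatten [seq val (y i) | i <- enum 'I_(rar P)])))))].

Definition i_isomorphic (T : theory S') (K K' : translation S S') : Prop :=
  exists F, i_isomorphism T K K' F.

(* The equivalences are not relativized to the domain; this makes no difference
   for coincidence with the identity, whose domain is everything. *)
Definition coincide (T : theory S') (K K' : translation S S') : Prop :=
  [/\ dim K = dim K',
      proves T (fIff (dom K) (dom K')),
      proves T (fIff (eqf K) (eqf K'))
    & forall P : rpred S, proves T (fIff (@trel S S' K P) (@trel S S' K' P))].

End Operations.
Arguments id_trans : clear implicits.

Definition bi_interpretation (SU SV : rsig) (U : theory SU) (V : theory SV)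
    (K : interp U V) (M : interp V U) : Prop :=
  i_isomorphic U (comp_trans M K) (id_trans SU) /\
  i_isomorphic V (comp_trans K M) (id_trans SV).

Definition synonymous (SU SV : rsig) (U : theory SU) (V : theory SV) : Prop :=
  exists (K : interp U V) (M : interp V U),
    coincide U (comp_trans M K) (id_trans SU) /\
    coincide V (comp_trans K M) (id_trans SV).

(** * Adjunctive class theory and conceptual theories *)

Inductive ac_sort := obj | cls.

Definition ac_sort_eqb (s s' : ac_sort) : bool :=
  match s, s' with obj, obj | cls, cls => true | _, _ => false end.

Lemma ac_sort_eqP : Equality.axiom ac_sort_eqb.
Proof. by case; case; constructor. Qed.

HB.instance Definition _ := hasDecEq.Build ac_sort ac_sort_eqP.

Definition ac_sig : msig :=
  @MSig ac_sort unit (fun=> 2) (fun _ i => if val i == 0 then obj else cls).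

(* Object variable [x] is a member of class variable [X]. *)
Definition ac_mem (x X : nat) : form ac_sig := @fRel ac_sig tt [tuple x; X].

Definition ac_empty : form ac_sig :=
  @fEx ac_sig cls (@fAll ac_sig obj (fNot (ac_mem 0 0))).

(* Object variables: 0 is x, 1 is y. Class variables: 0 is X, 1 is Y. *)
Definition ac_adjunction : form ac_sig :=
  @fAll ac_sig cls (@fAll ac_sig obj (@fEx ac_sig cls (@fAll ac_sig obj
    (fIff (ac_mem 0 0) (fOr (ac_mem 0 1) (@fEq ac_sig obj 0 1)))))).

Definition ac_extensionality : form ac_sig :=
  @fAll ac_sig cls (@fAll ac_sig cls
    (fImp (@fAll ac_sig obj (fIff (ac_mem 0 0) (ac_mem 0 1)))
          (@fEq ac_sig cls 0 1))).

Definition ac_axioms (A : form ac_sig) : Prop :=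
  [\/ A = ac_empty, A = ac_adjunction | A = ac_extensionality].

Lemma ac_axioms_sentence A : ac_axioms A -> sentence A.
Proof.
by case=> ->; rewrite /sentence /=; repeat (apply/andP; split=> //);
  apply/forallP; case=> [[|[|[]]] ?].
Qed.

Definition ac : theory ac_sig := Theory ac_axioms_sentence.

Definition o_direct (S : rsig) (T : theory S) (N : interp ac T) : Prop :=
  [/\ @tdim ac_sig S N obj = 1, @tdom ac_sig S N obj = @fEq S tt 0 0
    & @teq ac_sig S N obj = @fEq S tt 0 1].

Definition conceptual (S : rsig) (T : theory S) : Prop :=
  exists N : interp ac T, o_direct N.

(* Main.v *)
From Stdlib Require List.
From mathcomp Require Import all_boot boolp classical_sets.
Require Import Defs.
Set Implicit Arguments.
Unset Strict Implicit.
Unset Printing Implicit Defensive.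

(* By completeness, one may argue in models. Let [N] be a model of [V], with
   internal model [K N] of [U] on the subset [dom K]. The isomorphism of
   [M (K N)] with [N] injects the universe into [dom K], so a Schroeder-Bernstein
   argument, definable thanks to the classes of [ac], gives a bijection of the
   universe with [dom K]. Transporting [K] along it yields [K'] defined on the whole
   universe. For a model [W] of [U] there is now a definable isomorphism [h] of [W]
   with [K' (M W)], whose universe is [dom M]; transporting [M] along [h] yields [M']
   with [K' (M' W) = W]. For a model [N] of [V] put [N' := M' (K' N)]. Then
   [K' N' = K' N] and there is an isomorphism [R] from [N'] to [N]. It is an
   automorphism of [K' N], hence one of [N' = M' (K' N)]; being an isomorphism from
   [N'] both to [N] and to [N'], it forces [N = N']. *)

(** * Renaming *)

Section Renaming.
Variable S : msig.
Implicit Types (A B : form S) (r : sort_of S -> nat -> nat).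

Lemma ren_comp r r' A : ren r (ren r' A) = ren (fun s n => r s (r' s n)) A.
Proof.
elim: A r r' => //= [P a|A IA B IB|s A IA] r r'.
- by congr fRel; apply: eq_from_tnth => i; rewrite !tnth_mktuple.
- by rewrite IA IB.
- rewrite IA; congr (fAll _ (ren _ _)); apply/funext => s'; apply/funext => n.
  by rewrite /up_ren; case: eqP => // _; case: n.
Qed.

Lemma ren_fv n r r' A : fv_below n A ->
  (forall s i, i < n s -> r s i = r' s i) -> ren r A = ren r' A.
Proof.
elim: A n r r' => //= [s x y|P a|A IA B IB|s A IA] n r r'.
- by case/andP=> hx hy E; rewrite !E.
- move/forallP=> h E; congr fRel; apply: eq_from_tnth => i.
  by rewrite !tnth_mktuple E.
- by case/andP=> hA hB E; rewrite (IA _ _ r' hA E) (IB _ _ r' hB E).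
- move=> h E; congr fAll; apply: IA h _ => s' i; rewrite /up_ren.
  by case: eqP => [_|_]; [case: i => //= i hi; rewrite E | rewrite add0n => /E].
Qed.

Lemma fv_below_mono n n' A :
  (forall s, n s <= n' s) -> fv_below n A -> fv_below n' A.
Proof.
elim: A n n' => //= [s x y|P a|A IA B IB|s A IA] n n' h.
- by case/andP=> hx hy; rewrite !(leq_trans _ (h s)).
- by move/forallP=> ha; apply/forallP => i; apply: leq_trans (ha i) (h _).
- by case/andP=> /(IA _ _ h) -> /(IB _ _ h).
- by apply: IA => s'; rewrite leq_add2l.
Qed.

Lemma fv_ren n r A : (forall s i, r s i < n s) -> fv_below n (ren r A).
Proof.
elim: A n r => //= [s x y|P a|A IA B IB|s A IA] n r h.
- by rewrite !h.
- by apply/forallP => i; rewrite tnth_mktuple.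
- by rewrite IA // IB.
- by apply: IA => s' [|i]; rewrite /up_ren; case: eqP => //= _;
    rewrite ?add1n ?add0n ?ltnS.
Qed.

Lemma ren_id A : ren (fun _ n => n) A = A.
Proof.
elim: A => //= [P a|A IA B IB|s A IA].
- by congr fRel; apply: eq_from_tnth => i; rewrite tnth_mktuple.
- by rewrite IA IB.
- rewrite -[in RHS]IA; congr (fAll _ (ren _ _)).
  by apply/funext => s'; apply/funext => n; rewrite /up_ren; case: eqP; case: n.
Qed.

Lemma ren_sentence r A : sentence A -> ren r A = A.
Proof. by move=> h; rewrite -[RHS]ren_id; apply: ren_fv h _. Qed.

(** Induction on the derivation; [r] and [G'] are quantified after it because the rule for
    introducing a quantifier changes both. *)
Lemma prv_ren (G : form S -> Prop) A : prv G A ->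
  forall r (G' : form S -> Prop), (forall B, G B -> G' (ren r B)) ->
  prv G' (ren r A).
Proof.
have ren_inst r s x A' :
    ren r (ren (inst s x) A') = ren (inst s (r s x)) (ren (up_ren s r) A').
  rewrite !ren_comp; congr (ren _ _); apply/funext => s'; apply/funext => n.
  by rewrite /inst /up_ren; case: eqP => [->|//]; case: n.
elim=> {G A} /= [G A GA|G A B _ IH|G A B _ I1 _ I2|G A _ IH|G s A _ IH
  |G s A x _ IH|G s x|G s x y A _ I1 _ I2] r G' hG.
- by apply: prv_ax; apply: hG.
- by apply: prv_impI; apply: IH => C [->|/hG]; [left|right].
- by apply: prv_impE (I1 _ _ hG) (I2 _ _ hG).
- by apply: prv_raa; apply: IH => C [->|/hG]; [left|right].
- apply: prv_allI; apply: IH => _ [B /hG GB ->]; exists (ren r B) => //.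
  rewrite !ren_comp; congr (ren _ _); apply/funext => s'; apply/funext => n.
  by rewrite /shift /up_ren; case: eqP.
- by rewrite ren_inst; apply: prv_allE; apply: IH.
- exact: prv_eqI.
- rewrite ren_inst; apply: prv_eqE (I1 _ _ hG) _.
  by rewrite -ren_inst; apply: I2.
Qed.

Lemma prv_weak (G G' : form S -> Prop) A :
  (forall B, G B -> G' B) -> prv G A -> prv G' A.
Proof.
by move=> GG' h; rewrite -(ren_id A); apply: (prv_ren h) => B /GG'; rewrite ren_id.
Qed.

(** Strictly above every index that occurs, bound ones included: crude, but one number serves all
    sorts. *)
Fixpoint fv_bound A : nat :=
  match A with
  | fFalse => 0
  | fEq _ x y => (maxn x y).+1
  | fRel P a => \max_(i < ar P) (tnth a i).+1
  | fImp A B => maxn (fv_bound A) (fv_bound B)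
  | fAll _ A => fv_bound A
  end.

Lemma fv_bound_below A (n : sort_of S -> nat) :
  (forall s, fv_bound A <= n s) -> fv_below n A.
Proof.
elim: A n => //= [s x y|P a|A IA B IB|s A IA] n h.
- by have := h s; rewrite gtn_max.
- apply/forallP => i; apply: leq_trans (h (srt i)).
  exact: (leq_bigmax_cond (F := fun i => (tnth a i).+1)).
- by rewrite IA ?IB // => s; have := h s; rewrite geq_max => /andP[].
- by apply: IA => s'; apply: leq_trans (h s') _; apply: leq_addl.
Qed.

(** * Derived rules of natural deduction *)

Lemma prv_hyp1 (G : form S -> Prop) A : prv (fun C => C = A \/ G C) A.
Proof. by apply: prv_ax; left. Qed.

Lemma prvK (G : form S -> Prop) A B : prv G (fImp A (fImp B A)).
Proof. by do 2!apply: prv_impI; apply: prv_ax; right; left. Qed.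

Lemma prvS (G : form S -> Prop) A B C :
  prv G (fImp (fImp A (fImp B C)) (fImp (fImp A B) (fImp A C))).
Proof.
do 3!apply: prv_impI; apply: (@prv_impE _ _ B).
- apply: (@prv_impE _ _ A); last exact: prv_hyp1.
  by apply: prv_ax; right; right; left.
- by apply: (@prv_impE _ _ A); [apply: prv_ax; right; left|exact: prv_hyp1].
Qed.

Lemma prv_efq (G : form S -> Prop) A : prv G fFalse -> prv G A.
Proof. by move=> h; apply: prv_raa; apply: prv_weak h; right. Qed.

Lemma prv_notE (G : form S -> Prop) A B : prv G (fImp (fNot A) (fImp A B)).
Proof.
do 2!apply: prv_impI; apply: prv_efq; apply: (@prv_impE _ _ A).
- by apply: prv_ax; right; left.
- exact: prv_hyp1.
Qed.

(* Eigenvariable rule: [r] sends [x] to the bound index 0 and agrees with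
   [shift s] below [x]. *)
Lemma prv_all_fresh (G : form S -> Prop) s A x :
  (forall B, G B -> fv_below (fun=> x) B) -> fv_below (fun=> x) (fAll s A) ->
  prv G (ren (inst s x) A) -> prv G (fAll s A).
Proof.
move=> hG hA h; apply: prv_allI.
pose r s' n := if s' == s then (if n == x then 0 else n.+1) else n.
have -> : A = ren r (ren (inst s x) A).
  rewrite -[LHS]ren_id ren_comp.
  apply: (@ren_fv (fun s' => (s' == s) + x)) hA _ => s' i; rewrite /inst /r.
  case: eqP => //= _; case: i => [|i]; first by rewrite eqxx.
  by rewrite ltnS => hi; rewrite ltn_eqF.
apply: (prv_ren h) => B GB; exists B => //; apply: ren_fv (hG _ GB) _ => s' i hi.
by rewrite /r /shift; case: eqP => //= _; rewrite ltn_eqF.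
Qed.

(** A refutation of the Henkin implication proves both its premise and the negation of [fAll s A];
    as [x] is fresh, the premise generalizes, which is a contradiction. *)
Lemma prv_henkin (G : form S -> Prop) s A x :
  (forall B, G B -> fv_below (fun=> x) B) -> fv_below (fun=> x) (fAll s A) ->
  prv (fun C => C = fImp (ren (inst s x) A) (fAll s A) \/ G C) fFalse ->
  prv G fFalse.
Proof.
move=> hG hA h; have hN := prv_impI h.
have nall : prv G (fNot (fAll s A)).
  apply: prv_impI; apply: prv_impE (prv_weak _ hN) _; first by right.
  by apply: prv_impI; apply: prv_ax; right; left.
apply: prv_impE nall _; apply: prv_all_fresh hG hA _.
apply: prv_raa; apply: prv_impE (prv_weak _ hN) _; first by right.
apply: prv_impE; first exact: prv_notE.
exact: prv_hyp1.
Qed.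

End Renaming.

(** * Lindenbaum's lemma *)

(** Stated for an abstract implication because it is applied to families of formulas, with
    implication taken pointwise. *)
Lemma Lindenbaum (X : Type) (imp : X -> X -> X) (bot : X) (Pf : X -> Prop) :
  (forall a b, Pf (imp a (imp b a))) ->
  (forall a b c, Pf (imp (imp a (imp b c)) (imp (imp a b) (imp a c)))) ->
  (forall a b, Pf (imp a b) -> Pf a -> Pf b) -> ~ Pf bot ->
  exists U : X -> Prop, [/\ forall a, Pf a -> U a,
    forall a b, U (imp a b) -> U a -> U b, ~ U bot &
    forall a, ~ U a -> U (imp a bot)].
Proof.
move=> PK PS PMP Pbot.
pose th (U : set X) := [/\ forall a, Pf a -> U a,
  forall a b, U (imp a b) -> U a -> U b & ~ U bot].
have [F FP Ftot|U [U0 Umax]] := @Zorn_bigcup X (fun U => U = set0 \/ th U).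
  have [[V FV [a Va]]|F0] := EM (exists2 V, F V & exists a, V a).
  - right; have thF W b : F W -> W b -> th W.
      by move=> /FP[->|].
    split.
    + by move=> b Pb; exists V => //; have [h _ _] := thF _ _ FV Va; apply: h.
    + move=> b c [W FW Wb] [W' FW' W'c].
      have [WW'|W'W] := Ftot _ _ FW FW'.
      * exists W' => //; have [_ h _] := thF _ _ FW' W'c; apply: h W'c.
        exact: WW'.
      * exists W => //; have [_ h _] := thF _ _ FW Wb; apply: h Wb _.
        exact: W'W.
    + by move=> [W FW Wb]; have [_ _] := thF _ _ FW Wb.
  - left; rewrite -subset0 => a [W FW Wa]; apply: F0.
    by exists W => //; exists a.
have Uth : th U.
  case: U0 => // U0; exfalso; apply: (Umax Pf); last by right; split.
  rewrite U0; split; first by [].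
  by move=> /(_ _ (PK bot bot)).
case: (Uth) => UPf UMP Ubot; exists U; split=> // a Ua.
(* [W] consists of the consequences of [U] and [a]; it would be a larger theory if [U] did not
   refute [a]. *)
apply: contrapT => Una; pose W : set X := fun b => U (imp a b).
have WU b : U b -> W b by apply: (UMP); apply: UPf; apply: PK.
have Wa : W a.
  apply: (UMP _ _ _ (UPf _ (PK a a))); apply: (UMP _ _ _ (UPf _ (PK a (imp a a)))).
  exact/UPf/PS.
apply: (Umax W).
  by split=> // WU'; apply: Ua; apply: WU'.
right; split=> //.
- by move=> b /UPf/WU.
- move=> b c Wbc Wb; apply: (UMP _ _ _ Wb); apply: (UMP _ _ _ Wbc).
  exact/UPf/PS.
Qed.

(** * Semantics *)

Definition scons (D : Type) (d : D) (rho : nat -> D) (n : nat) : D :=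
  if n is m.+1 then rho m else d.

(* A structure carries a domain predicate instead of having its carrier as
   domain, so that the internal models of an interpretation all live on one
   carrier. A predicate takes a whole sequence of arguments, of which only the
   first [rar P] matter. *)
Record struct (S : rsig) (D : Type) := Struct {
  dm : D -> Prop;
  rl : rpred S -> (nat -> D) -> Prop;
  rl_ext : forall P v w, (forall i, i < rar P -> v i = w i) -> rl P v -> rl P w
}.

Section Semantics.
Variables (S : rsig) (D : Type).
Implicit Types (N : struct S D) (A B : form S) (rho : nat -> D).

Fixpoint sat N A rho : Prop :=
  match A with
  | fFalse => False
  | fEq _ x y => rho x = rho y
  | fRel P a => rl N P (fun i => rho (nth 0 a i))
  | fImp A B => sat N A rho -> sat N B rho
  | fAll _ A => forall d, dm N d -> sat N A (scons d rho)
  end.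

Definition into N rho := forall i, dm N (rho i).

Definition model (T : theory S) N :=
  forall A rho, axioms T A -> into N rho -> sat N A rho.

Lemma into_scons N d rho : dm N d -> into N rho -> into N (scons d rho).
Proof. by move=> hd hr []. Qed.

Lemma rl_eq N P v w : (forall i, i < rar P -> v i = w i) -> rl N P v <-> rl N P w.
Proof. by move=> E; split; apply: rl_ext => // i /E. Qed.

Lemma sat_ren N r A rho : sat N (ren r A) rho <-> sat N A (fun n => rho (r tt n)).
Proof.
elim: A r rho => //= [[] x y|P a|A IA B IB|[] A IA] r rho //.
- apply: rl_eq => i hi; rewrite (nth_map (Ordinal hi)) ?size_enum_ord //.
  by rewrite (tnth_nth 0) nth_enum_ord.
- by rewrite IA IB.
- have E d : (fun n => scons d rho (@up_ren S tt r tt n)) =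
    scons d (fun n => rho (r tt n)) by apply/funext; case.
  by split=> h d hd; have := h d hd; rewrite IA E.
Qed.

Lemma sat_fv N n A rho rho' : fv_below (fun=> n) A ->
  (forall i, i < n -> rho i = rho' i) -> sat N A rho <-> sat N A rho'.
Proof.
elim: A n rho rho' => //= [_ x y|P a|A IA B IB|[] A IA] n rho rho'.
- by case/andP=> hx hy E; rewrite !E.
- move/forallP=> h E; apply: rl_eq => i hi; apply: E.
  by have := h (Ordinal hi); rewrite (tnth_nth 0).
- by case/andP=> hA hB E; rewrite (IA _ _ _ hA E) (IB _ _ _ hB E).
- move=> h E.
  have h' : @fv_below S (fun=> n.+1) A.
    by congr fv_below: h; apply/funext; case.
  by split=> hA d hd; have := hA d hd; apply: iffLR; apply: IA h' _ => -[|i] //=;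
    rewrite ltnS => /E.
Qed.

Lemma sat_inst N x A rho :
  sat N (ren (@inst S tt x) A) rho <-> sat N A (scons (rho x) rho).
Proof.
rewrite sat_ren; have -> // : (fun n => rho (@inst S tt x tt n)) = scons (rho x) rho.
by apply/funext; case.
Qed.

Lemma soundness (G : form S -> Prop) A N rho : prv G A -> into N rho ->
  (forall B, G B -> sat N B rho) -> sat N A rho.
Proof.
move=> h; elim: h rho => {G A} [G A GA|G A B _ IH|G A B _ I1 _ I2|G A _ IH
  |G [] A _ IH|G [] A x _ IH|G s x|G [] x y A _ I1 _ I2] rho hr hG //=.
- exact: hG.
- by move=> hA; apply: IH => // C [->|/hG].
- exact: I1 (I2 _ _ _).
- by apply: contrapT => nA; apply: (IH rho) => // C [->|/hG].
- move=> d hd; apply: IH; first exact: into_scons.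
  by move=> _ [B /hG hB ->]; rewrite sat_ren.
- by apply/sat_inst; apply: (IH rho).
- have /= E := I1 _ hr hG; have := I2 _ hr hG.
  by rewrite !sat_inst E.
Qed.

Lemma model_sat T N A rho : model T N -> proves T A -> into N rho -> sat N A rho.
Proof. by move=> hN hA hr; apply: (soundness hA hr) => B hB; apply: hN. Qed.

Lemma model_imp T N A B rho : model T N -> proves T (fImp A B) -> into N rho ->
  sat N A rho -> sat N B rho.
Proof. exact: model_sat. Qed.

Lemma sat_appf N A xs rho :
  sat N (appf A xs) rho <-> sat N A (fun i => rho (nth 0 xs i)).
Proof. exact: sat_ren. Qed.

Lemma sat_imp N A B rho : sat N (fImp A B) rho = (sat N A rho -> sat N B rho).
Proof. by []. Qed.

Lemma sat_and N A B rho : sat N (fAnd A B) rho <-> sat N A rho /\ sat N B rho.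
Proof.
split=> /= [h|[hA hB] h]; last exact: h hA hB.
by split; apply: contrapT => n; apply: h => hA hB; [apply: n hA|apply: n hB].
Qed.

Lemma sat_or N A B rho : sat N (fOr A B) rho <-> sat N A rho \/ sat N B rho.
Proof.
split=> /= [h|[hA|hB] //]; have [hA|nA] := EM (sat N A rho); first by left.
by right; apply: h.
Qed.

Lemma sat_iff N A B rho :
  sat N (fIff A B) rho <-> (sat N A rho <-> sat N B rho).
Proof. by rewrite /fIff sat_and /=; split=> [[]|[]]. Qed.

Lemma sat_ex N A rho :
  sat N (@fEx S tt A) rho <-> exists2 d, dm N d & sat N A (scons d rho).
Proof.
split=> /= [h|[d hd hA] h]; last exact: h hA.
by apply: contrapT => n; apply: h => d hd hA; apply: n; exists d.
Qed.

Lemma sat_conj (X : eqType) N (f : X -> form S) s rho :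
  sat N (fConj [seq f i | i <- s]) rho <-> (forall i, i \in s -> sat N (f i) rho).
Proof.
elim: s => [|x s IH]; first by split=> // _ [].
change (sat N (fAnd (f x) (fConj [seq f i | i <- s])) rho <->
  (forall i, i \in x :: s -> sat N (f i) rho)).
rewrite sat_and IH; split=> [[hx hs] i|h].
  by rewrite inE => /predU1P[->|/hs].
by split=> [|i hi]; apply: h; rewrite inE ?eqxx ?hi ?orbT.
Qed.

(** The outermost of [n] quantifiers binds index [n - 1], so a block can be read as one quantifier
    over functions [f], of which the first [n] values count. *)
Definition sprefix (n : nat) (f rho : nat -> D) (i : nat) : D :=
  if i < n then f i else rho (i - n).

Lemma into_sprefix N n f rho : into N f -> into N rho -> into N (sprefix n f rho).
Proof. by move=> hf hr i; rewrite /sprefix; case: ifP. Qed.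

Lemma sprefixS n f rho : sprefix n f (scons (f n) rho) = sprefix n.+1 f rho.
Proof.
apply/funext => i; rewrite /sprefix ltnS; case: (ltngtP i n) => h //.
- by rewrite -(subnSK h).
- by rewrite h subnn.
Qed.

Lemma sat_alls N n A rho : into N rho ->
  sat N (@fAlls S tt n A) rho <-> (forall f, into N f -> sat N A (sprefix n f rho)).
Proof.
have E0 f r : sprefix 0 f r = r by apply/funext => i; rewrite /sprefix subn0.
elim: n rho => [|n IH] rho hr /=.
  by split=> [h f _|/(_ rho hr)]; rewrite E0.
split=> [h f hf|h d hd].
  have hi : into N (scons (f n) rho) by exact: into_scons.
  by rewrite -sprefixS; apply: (iffLR (IH _ hi) (h _ (hf n)) f hf).
apply/IH => [|f hf]; first exact: into_scons.
pose f' i := if i == n then d else f i.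
have En : f' n = d by rewrite /f' eqxx.
have := h f'; rewrite -sprefixS En.
have -> : sprefix n f' (scons d rho) = sprefix n f (scons d rho).
  by apply/funext => i; rewrite /sprefix; case: ifP => // hi; rewrite /f' ltn_eqF.
by apply => i; rewrite /f'; case: ifP.
Qed.

Lemma sat_exs N n A rho : into N rho ->
  sat N (@fExs S tt n A) rho <-> (exists2 f, into N f & sat N A (sprefix n f rho)).
Proof.
move=> hr; have -> : sat N (@fExs S tt n A) rho <-> sat N (fNot (@fAlls S tt n (fNot A))) rho.
  elim: n rho hr => [|n IH] rho hr /=.
    by split=> [h /(_ h)|h //]; apply: contrapT.
  split=> h h'; apply: h => d hd.
    have hd' : into N (scons d rho) by exact: into_scons.
    by move/(IH _ hd'); apply; apply: h'.
  have hd' : into N (scons d rho) by exact: into_scons.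
  by have := h' d hd; rewrite /= (IH _ hd') /= => /contrapT.
rewrite /= sat_alls //; split=> [h|[f hf hA] h]; last exact: h hA.
by apply: contrapT => n'; apply: h => f hf hA; apply: n'; exists f.
Qed.

End Semantics.

(** * Completeness *)

(* The signature may be uncountable while there are only countably many
   variables, so no maximal consistent set of formulas need have witnesses
   in the variables. For every finite list [l] of formulas the Henkin axioms for
   instances of members of [l] can be witnessed by variables, and the model is an
   ultraproduct over all [l]: its elements are functions from lists to variables,
   and truth is a maximal consistent set of families [l |-> formula]. *)
Section Completeness.
Variables (S : rsig) (T : theory S) (A0 : form S).
Hypothesis T_A0 : ~ proves T A0.
Local Notation F := (form S).
Implicit Types (l : seq F) (phi psi : seq F -> F).

(** A code stands for a position [k] in [l] and a list [s] of variables replacing the parameters, so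
    that the Henkin axioms can be added one at a time; other codes give [fFalse]. *)
Definition henkin_body l (c : nat) : F :=
  if unpickle c is Some (k, s) then
    ren (@up_ren S tt (fun _ i => nth 0 s i)) (nth fFalse l (k : nat))
  else fFalse.

Definition witness l c (G : seq F) : nat :=
  maxn (fv_bound (henkin_body l c)) (\max_(B <- G) fv_bound B).

Definition henkin_axiom l c x : F :=
  fImp (ren (@inst S tt x) (henkin_body l c)) (@fAll S tt (henkin_body l c)).

Fixpoint henkin l c : seq F :=
  if c is c'.+1 then
    henkin_axiom l c' (witness l c' (henkin l c')) :: henkin l c'
  else [:: fNot A0].

Definition hyps l c (B : F) : Prop := axioms T B \/ List.In B (henkin l c).

Lemma henkin_mono l c c' B :
  c <= c' -> List.In B (henkin l c) -> List.In B (henkin l c').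
Proof.
by move/subnK <-; elim: (c' - c) => //= n IH /IH; right.
Qed.

Lemma prv_hyps_mono l c c' A : c <= c' -> prv (hyps l c) A -> prv (hyps l c') A.
Proof.
move=> h; apply: prv_weak => B [|/(henkin_mono h)]; first by left.
by right.
Qed.

Lemma fv_below_henkin l c x :
  witness l c (henkin l c) <= x ->
  (forall B, hyps l c B -> fv_below (fun=> x) B) /\
  fv_below (fun=> x) (@fAll S tt (henkin_body l c)).
Proof.
rewrite geq_max => /andP[hb hG]; split; last first.
  by apply: fv_bound_below => s.
move=> B [/axioms_sentence hB|hB].
  by apply: fv_below_mono hB => s.
apply: fv_bound_below => _; apply: leq_trans hG.
elim: (henkin l c) hB => //= C G IH [->|/IH h]; rewrite big_cons.
  exact: leq_maxl.
exact: leq_trans h (leq_maxr _ _).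
Qed.

(** At stage 0 a contradiction would make [T] prove [A0]; each later stage adds one Henkin axiom
    with a fresh witness, harmless by [prv_henkin]. *)
Lemma hyps_consistent l c : ~ prv (hyps l c) fFalse.
Proof.
elim: c => [|c IH] h; last first.
  apply: IH; have [hG hA] := fv_below_henkin (leqnn (witness l c (henkin l c))).
  apply: (prv_henkin hG hA); apply: prv_weak h => B [hB|[<-|hB]].
  - by right; left.
  - by left.
  - by right; right.
apply: T_A0; apply: prv_raa; apply: prv_weak h => B [hB|[<-|[]]].
- by right.
- by left.
Qed.

Lemma henkin_witness l A (r : nat -> nat) : List.In A l ->
  exists x c, List.In
    (fImp (ren (fun _ => scons x r) A) (@fAll S tt (ren (@up_ren S tt (fun=> r)) A)))
    (henkin l c).
Proof.
move=> Al; have [k Ek] : exists k, nth fFalse l k = A.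
  elim: l Al => //= B l IH [->|/IH[k Ek]]; first by exists 0.
  by exists k.+1.
(* Only the values of [r] below [fv_bound A] affect [A], so a finite list codes the instance. *)
pose s := mkseq r (fv_bound A); pose c := pickle (k, s).
have Eb : henkin_body l c = ren (@up_ren S tt (fun=> r)) A.
  rewrite /henkin_body pickleK Ek.
  apply: (@ren_fv S (fun=> (fv_bound A).+1)) => [|[] [|i] // hi].
    by apply: fv_bound_below => _.
  by rewrite /up_ren /= nth_mkseq.
exists (witness l c (henkin l c)), c.+1; left.
rewrite /henkin_axiom Eb ren_comp; congr (fImp (ren _ _) _).
by apply/funext => -[]; apply/funext => -[].
Qed.

(** The lists containing all members of a fixed [l0] generate the filter of the ultraproduct; the
    stage [c] may depend on [l]. *)
Definition eventually_provable phi : Prop := exists l0, forall l,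
  (forall B, List.In B l0 -> List.In B l) -> exists c, prv (hyps l c) (phi l).
Local Notation Pf := eventually_provable.

Lemma Pf_prv phi : (forall l c, prv (hyps l c) (phi l)) -> Pf phi.
Proof. by move=> h; exists [::] => l _; exists 0. Qed.

Lemma Pf_MP phi psi : Pf (fun l => fImp (phi l) (psi l)) -> Pf phi -> Pf psi.
Proof.
move=> [l1 h1] [l2 h2]; exists (l1 ++ l2) => l hl.
have [c1 p1] : exists c, prv (hyps l c) (fImp (phi l) (psi l)).
  by apply: h1 => B hB; apply: hl; apply: List.in_or_app; left.
have [c2 p2] : exists c, prv (hyps l c) (phi l).
  by apply: h2 => B hB; apply: hl; apply: List.in_or_app; right.
exists (maxn c1 c2); apply: prv_impE.
  exact: prv_hyps_mono (leq_maxl _ _) p1.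
exact: prv_hyps_mono (leq_maxr _ _) p2.
Qed.

Lemma countermodel : exists D (N : struct S D) rho,
  [/\ model T N, into N rho & ~ sat N A0 rho].
Proof.
have [||||U [UPf UMP Ubot Unot]] := @Lindenbaum (seq F -> F)
  (fun phi psi l => fImp (phi l) (psi l)) (fun=> fFalse) Pf.
- by move=> a b; apply: Pf_prv => l c; apply: prvK.
- by move=> a b d; apply: Pf_prv => l c; apply: prvS.
- exact: Pf_MP.
- by case=> l0 /(_ l0 (fun _ h => h)) [c]; apply: hyps_consistent.
have Uimp phi psi : U (fun l => fImp (phi l) (psi l)) <-> (U phi -> U psi).
  split=> [|h]; first exact: UMP.
  have [hp|/Unot hn] := EM (U phi).
    by apply: UMP (h hp); apply/UPf/Pf_prv => l c; apply: prvK.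
  by apply: UMP hn; apply/UPf/Pf_prv => l c; apply: prv_notE.
pose E f g := U (fun l => @fEq S tt (f l) (g l)).
have eqE A (r : seq F -> nat -> nat) f g : E f g ->
    U (fun l => ren (fun _ => scons (f l) (r l)) A) ->
    U (fun l => ren (fun _ => scons (g l) (r l)) A).
  move=> Efg; apply/Uimp; apply: UMP Efg; apply/UPf/Pf_prv => l c.
  have inst_scons x :
      ren (fun _ => scons x (r l)) A =
      ren (@inst S tt x) (ren (@up_ren S tt (fun=> r l)) A).
    rewrite ren_comp; congr ren.
    by apply/funext => -[]; apply/funext => -[].
  do 2!apply: prv_impI; rewrite !inst_scons; apply: prv_eqE.
    by apply: prv_ax; right; left.
  exact: prv_hyp1.
have Erefl f : E f f by apply/UPf/Pf_prv => l c; apply: prv_eqI.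
have Esym f g : E f g -> E g f.
  by move=> h; apply: (eqE (@fEq S tt 0 1) (fun l _ => f l) f g h); apply: Erefl.
have Etrans f g h : E f g -> E g h -> E f h.
  move=> Efg Egh; apply: (eqE (@fEq S tt 1 0) (fun l _ => f l) g h Egh).
  exact: Efg.
(* One representative per class of [E], so that identity becomes true equality in [N]. *)
pose rep f : seq F -> nat := xget (fun=> 0) (E f).
have repE f : E f (rep f) by apply: xgetPex; exists f.
have rep_eq f g : E f g -> rep f = rep g.
  move=> Efg; congr xget; apply/funext => h; apply/propext; split.
    by apply: Etrans; apply: Esym.
  exact: Etrans.
have rep_ext P (v w : nat -> seq F -> nat) : (forall i, i < rar P -> v i = w i) ->
    U (fun l => @fRel S P [tuple v i l | i < rar P]) ->
    U (fun l => @fRel S P [tuple w i l | i < rar P]).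
  move=> Evw; congr U; apply/funext => l; congr fRel.
  by apply: eq_from_tnth => i; rewrite !tnth_mktuple Evw.
pose N := @Struct S (seq F -> nat) (fun f => f = rep f) _ rep_ext.
have truth A sig : into N sig ->
    sat N A sig <-> U (fun l => ren (fun _ n => sig n l) A).
  elim: A sig => [|[] x y|P a|A IA B IB|[] A IA] sig hs.
  - by split.
  - split=> [/= ->|]; first exact: Erefl.
    by move/rep_eq; rewrite /= -!hs.
  - rewrite /=; have -> // : (fun l => @fRel S P [tuple sig (nth 0 a i) l | i < rar P])
      = (fun l => @fRel S P [tuple sig (tnth a i) l | i < rar P]).
    apply/funext => l; congr fRel; apply: eq_from_tnth => i.
    by rewrite !tnth_mktuple (tnth_nth 0).
  - by rewrite /= Uimp IA // IB.
  - have ren_scons d : (fun l => ren (fun _ n => scons d sig n l) A) =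
        (fun l => ren (fun _ => scons (d l) (sig^~ l)) A).
      apply/funext => l; congr ren; apply/funext => -[].
      by apply/funext => -[].
    split=> /= h; last first.
      move=> d hd; rewrite IA; last exact: into_scons.
      rewrite ren_scons; apply: UMP h; apply/UPf/Pf_prv => l c.
      apply: prv_impI; have -> : ren (fun _ => scons (d l) (sig^~ l)) A =
        ren (@inst S tt (d l)) (ren (@up_ren S tt (fun=> sig^~ l)) A).
        by rewrite ren_comp; congr ren; apply/funext => -[]; apply/funext => -[].
      by apply: prv_allE; apply: prv_hyp1.
    (* [g] picks a Henkin witness at each list containing [A], and 0 elsewhere; lists of the first
       kind suffice for [eventually_provable]. *)
    have /choice[g hg] l : exists x, List.In A l -> exists c, List.In
        (fImp (ren (fun _ => scons x (sig^~ l)) A)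
           (@fAll S tt (ren (@up_ren S tt (fun=> sig^~ l)) A))) (henkin l c).
      have [Al|nAl] := EM (List.In A l); last by exists 0.
      by have [x hx] := henkin_witness (sig^~ l) Al; exists x.
    apply: (UMP (fun l => ren (fun _ => scons (g l) (sig^~ l)) A)).
      apply: UPf; exists [:: A] => l hl.
      have [|c hc] := hg l; first by apply: hl; left.
      by exists c; apply: prv_ax; right.
    apply: (eqE _ _ (rep g)); first exact: Esym.
    rewrite -ren_scons -IA; first by apply: h; apply: rep_eq.
    by apply: into_scons => //; apply: rep_eq.
(* Values are replaced by equivalent ones in one variable after another. *)
have ren_rep n A (sig tau : nat -> seq F -> nat) : (forall i, E (sig i) (tau i)) ->
    U (fun l => ren (fun _ i => sig i l) A) ->
    U (fun l => ren (fun _ i => if i < n then tau i l else sig i l) A).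
  move=> Est h; elim: n => [//|n IH].
  pose r l i := if i < n then tau i l else sig i l.
  have step f : (fun l => ren (fun _ i => if i == n then f l else r l i) A) =
      (fun l => ren (fun _ => scons (f l) (r l))
         (ren (fun _ i => if i == n then 0 else i.+1) A)).
    apply/funext => l; rewrite ren_comp; congr ren.
    by apply/funext => -[]; apply/funext => i; case: eqP.
  have -> : (fun l => ren (fun _ i => if i < n.+1 then tau i l else sig i l) A) =
      (fun l => ren (fun _ i => if i == n then tau n l else r l i) A).
    apply/funext => l; congr ren; apply/funext => -[]; apply/funext => i.
    by rewrite ltnS leq_eqVlt; case: eqP => [->|].
  rewrite step; apply: eqE (Est n) _; rewrite -step; congr U: IH.
  apply/funext => l; congr ren; apply/funext => -[]; apply/funext => i.
  by rewrite /r; case: eqP => // ->; rewrite ltnn.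
(* Variable [n] denotes the class of the constant family [n]. Truth of [A0] would thus put the
   constant family [A0] in [U], although every [henkin l 0] contains its negation. *)
exists (seq F -> nat), N, (fun n => rep (fun=> n)).
have hrep : into N (fun n => rep (fun=> n)) by move=> i; apply: rep_eq.
split=> //.
- move=> B sig hB hs; rewrite truth //; apply/UPf/Pf_prv => l c.
  by rewrite ren_sentence; [apply: prv_ax; left|apply: axioms_sentence hB].
- rewrite truth // => h; apply: Ubot; apply: UMP (_ : U (fun=> A0)).
    apply: UPf; exists [::] => l _; exists 0; apply: prv_ax.
    by right; left.
  have := ren_rep (fv_bound A0) A0 _ (fun n => fun=> n) _ h.
  have -> : (fun l => ren (fun _ i =>
     if i < fv_bound A0 then i else rep (fun=> i) l) A0) = (fun=> A0).
    apply/funext => l; rewrite -[RHS]ren_id; apply: (@ren_fv S (fun=> fv_bound A0)).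
      exact: fv_bound_below.
    by move=> _ i ->.
  by apply=> i; apply: Esym.
Qed.

End Completeness.

Theorem completeness (S : rsig) (T : theory S) (A : form S) :
  (forall D (N : struct S D) rho, model T N -> into N rho -> sat N A rho) ->
  proves T A.
Proof.
move=> h; apply: contrapT => /countermodel[D [N [rho [hN hr]]]]; apply.
exact: h.
Qed.

(** * Isomorphisms *)

(** Graphs instead of functions, because the bijections come from formulas. *)
Record bij (X Y : Type) (p : X -> Prop) (q : Y -> Prop) (R : X -> Y -> Prop) := Bij {
  bij_dom : forall x y, R x y -> p x /\ q y;
  bij_total : forall x, p x -> exists y, R x y;
  bij_onto : forall y, q y -> exists x, R x y;
  bij_eq : forall x y x' y', R x y -> R x' y' -> x = x' <-> y = y'
}.

Record iso (S : rsig) (X Y : Type) (A : struct S X) (B : struct S Y)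
    (R : X -> Y -> Prop) := Iso {
  iso_bij : bij (dm A) (dm B) R;
  iso_rl : forall P v w, (forall i, R (v i) (w i)) -> rl A P v <-> rl B P w
}.

Section Bijections.
Variables (X Y Z : Type) (p : X -> Prop) (q : Y -> Prop) (t : Z -> Prop).

Lemma bij_sym R : bij p q R -> bij q p (fun y x => R x y).
Proof.
move=> [h1 h2 h3 h4]; split=> // [x y /h1[]|x y x' y' hx hy] //.
by rewrite (h4 _ _ _ _ hx hy).
Qed.

Lemma bij_comp R R' : bij p q R -> bij q t R' ->
  bij p t (fun x z => exists2 y, R x y & R' y z).
Proof.
move=> [h1 h2 h3 h4] [k1 k2 k3 k4]; split.
- by move=> x z [y /h1[px _] /k1[_ tz]].
- move=> x /h2[y Rxy]; have [_ /k2[z hz]] := h1 _ _ Rxy.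
  by exists z; exists y.
- move=> z /k3[y Ryz]; have [/h3[x hx] _] := k1 _ _ Ryz.
  by exists x; exists y.
- move=> x z x' z' [y hy hz] [y' hy' hz'].
  by rewrite (h4 _ _ _ _ hy hy') (k4 _ _ _ _ hz hz').
Qed.

End Bijections.

Section Isomorphisms.
Variables (S : rsig) (X Y Z : Type).
Variables (A : struct S X) (B : struct S Y) (C : struct S Z).

Lemma iso_sym R : iso A B R -> iso B A (fun y x => R x y).
Proof.
by move=> [h1 h2]; split=> [|P v w hvw]; [apply: bij_sym|rewrite (h2 _ w v)].
Qed.

Lemma iso_comp R R' : iso A B R -> iso B C R' ->
  iso A C (fun x z => exists2 y, R x y & R' y z).
Proof.
move=> [h1 h2] [k1 k2]; split=> [|P v w hvw]; first exact: bij_comp h1 k1.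
have /choice[u hu] : forall i, exists y, R (v i) y /\ R' y (w i).
  by move=> i; have [y] := hvw i; exists y.
rewrite (h2 P v u) => [|i]; last by have [] := hu i.
by apply: k2 => i; have [] := hu i.
Qed.

Lemma iso_ext R R' : (forall x y, R x y <-> R' x y) -> iso A B R -> iso A B R'.
Proof.
move=> E; have -> // : R = R'.
by apply/funext => x; apply/funext => y; apply/propext.
Qed.

Lemma sat_iso R F rho rho' : iso A B R -> (forall i, R (rho i) (rho' i)) ->
  sat A F rho <-> sat B F rho'.
Proof.
move=> [[h1 h2 h3 h4] h5].
elim: F rho rho' => [|_ x y|P a|F IF G IG|_ F IF] rho rho' hr //=.
- exact: h4.
- by apply: h5.
- by rewrite (IF _ _ hr) (IG _ _ hr).
- split=> h d hd.
    have [d' hd'] := h3 _ hd; have [da _] := h1 _ _ hd'.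
    have E i : R (scons d' rho i) (scons d rho' i) by case: i.
    by apply/(IF _ _ E); apply: h.
  have [d' hd'] := h2 _ hd; have [_ db] := h1 _ _ hd'.
  have E i : R (scons d rho i) (scons d' rho' i) by case: i.
  by apply/(IF _ _ E); apply: h.
Qed.

Lemma model_iso (T : theory S) R : iso A B R -> model T A -> model T B.
Proof.
move=> hR hA F rho ax hr; have [h1 _ h3 _] := iso_bij hR.
have /choice[rho' hr'] : forall i, exists x, R x (rho i) by move=> i; apply: h3.
apply/(sat_iso F hR hr'); apply: hA => // i.
by have [] := h1 _ _ (hr' i).
Qed.

End Isomorphisms.

(** An isomorphism from [A] to [A'] with this graph expresses that they have the same domain and the
    same predicates on it. *)
Definition diag (S : rsig) (D : Type) (A : struct S D) (x y : D) := x = y /\ dm A x.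

Lemma iso_cancel (S : rsig) (D E : Type) (A A' : struct S D) (B : struct S E) R R' :
  iso A B R -> iso A' B R' -> (forall x y, R x y <-> R' x y) -> iso A A' (diag A).
Proof.
move=> hR hR' E0; apply: iso_ext (iso_comp hR (iso_sym hR')) => x y.
have [h1 h2 h3 h4] := iso_bij hR.
split=> [[z Rxz /E0 Ryz]|[<- hx]].
  by split; [apply/(h4 _ _ _ _ Rxz Ryz)|have [] := h1 _ _ Rxz].
by have [z Rz] := h2 _ hx; exists z => //; apply/E0.
Qed.

(** * Internal models of one-dimensional identity-preserving translations *)

Section InternalModel.
Variables (S S' : rsig) (t : translation S S').
Hypothesis t_scoped : well_scoped t.
Hypothesis t_dim : dim t = 1.
Hypothesis t_eq : identity_preserving t.

Lemma sum_dim (n : nat) : \sum_(i < n) dim t = n.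
Proof. by rewrite sum_nat_const card_ord t_dim muln1. Qed.

Lemma fv_dom : @fv_below S' (fun=> 1) (dom t).
Proof. by have [h _ _] := t_scoped; have := h tt; rewrite -/(dim t) t_dim. Qed.

Lemma fv_rel P : @fv_below S' (fun=> rar P) (@trel S S' t P).
Proof.
have [_ _ h] := t_scoped; have := h P; congr fv_below.
by apply/funext => _; apply: sum_dim.
Qed.

Variable D : Type.
Implicit Type N : struct S' D.

Lemma internal_ext N P v w : (forall i, i < rar P -> v i = w i) ->
  sat N (@trel S S' t P) v -> sat N (@trel S S' t P) w.
Proof. by move=> E; apply: iffLR; apply: sat_fv (fv_rel P) E. Qed.

Definition internal N : struct S D :=
  @Struct S D (fun x => dm N x /\ sat N (dom t) (fun=> x))
    (fun P v => sat N (@trel S S' t P) v) (@internal_ext N).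

(** In dimension one an environment is a map [e] of variables; it is kept arbitrary because each
    quantifier extends it. *)
Lemma sat_translate_in N A (e : nat -> nat) rho :
  sat N (translate_in t (fun _ n => [:: e n]) A) rho <->
  sat (internal N) A (fun n => rho (e n)).
Proof.
elim: A e rho => //= [[] x y|P a|A IA B IB|[] A IA] e rho.
- by rewrite sat_appf -/(eqf t) t_eq.
- rewrite sat_appf; apply: sat_fv (fv_rel P) _ => i hi; congr rho.
  rewrite flatten_map1.
  by rewrite (nth_map (Ordinal hi)) ?size_enum_ord // (tnth_nth 0) nth_enum_ord.
- by rewrite IA IB.
- have E : @up_env S S' t tt (fun _ n => [:: e n]) =
      (fun _ n => [:: scons 0 (fun m => (e m).+1) n]).
    by apply/funext => -[]; apply/funext => -[|n];
      rewrite /up_env /= -/(dim t) t_dim.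
  have Ed d : (fun n => scons d rho (scons 0 (fun m => (e m).+1) n)) =
    scons d (fun n => rho (e n)) by apply/funext; case.
  have dE d : sat N (dom t) (scons d rho) <-> sat N (dom t) (fun=> d).
    by apply: sat_fv fv_dom _ => -[].
  rewrite E -/(dim t) t_dim /= -/(dom t); split=> h d.
    by case=> hd hdom; rewrite -Ed -IA; apply: h => //; apply/dE.
  by move=> hd /dE hdom; rewrite IA Ed; apply: h.
Qed.

Lemma sat_translate N A rho : sat N (translate t A) rho <-> sat (internal N) A rho.
Proof.
rewrite -(sat_translate_in N A id) /translate.
have -> // : (fun (s : sort_of S) n => iota (n * tdim t s) (tdim t s)) =
  (fun _ n => [:: n]).
by apply/funext => -[]; apply/funext => n; rewrite -/(dim t) t_dim muln1.
Qed.

End InternalModel.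

(** Isomorphisms preserve the formulas defining the internal models, so the same graph works once
    restricted to the internal domain. *)
Lemma internal_iso (S S' : rsig) (t : translation S S') (ht : well_scoped t)
    (h1 : dim t = 1) (D E : Type) (A : struct S' D) (B : struct S' E) R :
  iso A B R ->
  iso (internal ht h1 A) (internal ht h1 B)
      (fun x y => R x y /\ sat A (dom t) (fun=> x)).
Proof.
move=> hR; have [b1 b2 b3 b4] := iso_bij hR.
have hd x y : R x y -> sat A (dom t) (fun=> x) <-> sat B (dom t) (fun=> y).
  by move=> Rxy; apply: sat_iso hR _.
split=> [|P v w hvw]; last by apply: sat_iso hR _ => i; have [] := hvw i.
split=> /=.
- by move=> x y [Rxy hx]; have [dx dy] := b1 _ _ Rxy; split=> //; rewrite -(hd x).
- by move=> x [/b2[y Rxy] hx]; exists y.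
- by move=> y [/b3[x Rxy] hy]; exists x; rewrite (hd x y).
- by move=> x y x' y' [h _] [h' _]; apply: b4.
Qed.

Section FreeVariables.
Variable S : rsig.
Implicit Types A B : form S.

Lemma fv_appf n A xs : 0 < n -> all (gtn n) xs -> fv_below (fun=> n) (appf A xs).
Proof.
move=> n0 hxs; apply: fv_ren => _ i; have [hi|hi] := ltnP i (size xs).
  by apply: (all_nthP 0 hxs).
by rewrite nth_default.
Qed.

Lemma fv_and n A B : fv_below n (fAnd A B) = fv_below n A && fv_below n B.
Proof. by rewrite /= !andbT. Qed.

Lemma fv_exs n k A :
  fv_below (fun=> n + k) A -> fv_below (fun=> n) (@fExs S tt k A).
Proof.
elim: k n => [|k IH] n /= h; first by rewrite addn0 in h.
rewrite andbT.
have -> : (fun s' : unit => (s' == tt) + n) = (fun=> n.+1) by apply/funext; case.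
by rewrite andbT IH // addSnnS.
Qed.

Lemma fv_conj (X : eqType) n (f : X -> form S) s :
  (forall x, x \in s -> fv_below n (f x)) -> fv_below n (fConj [seq f x | x <- s]).
Proof.
elim: s => //= x s IH h; rewrite !andbT h ?mem_head //=.
by apply: IH => y hy; apply: h; rewrite inE hy orbT.
Qed.

End FreeVariables.

(** * Definable relations *)

(** Variable 0 of [F] is the first argument and variable 1 the second; all further variables also
    get [y], to stay in the domain. *)
Definition defrel (S : rsig) (D : Type) (N : struct S D) (F : form S) (x y : D) :=
  [/\ dm N x, dm N y & sat N F (scons x (fun=> y))].

Lemma sat_appf1 (S : rsig) (D : Type) (N : struct S D) (F : form S) a rho :
  fv_below (fun=> 1) F -> sat N (appf F [:: a]) rho <-> sat N F (fun=> rho a).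
Proof. by move=> hF; rewrite sat_appf; apply: sat_fv hF _ => -[]. Qed.

Lemma sat_appf2 (S : rsig) (D : Type) (N : struct S D) (F : form S) a b rho :
  fv_below (fun=> 2) F ->
  sat N (appf F [:: a; b]) rho <-> sat N F (scons (rho a) (fun=> rho b)).
Proof. by move=> hF; rewrite sat_appf; apply: sat_fv hF _ => -[|[]]. Qed.

(** * Transport of a translation along a definable bijection *)

Section Pullback.
Variables (S S' : rsig) (t : translation S S') (G : form S').
Hypothesis t_scoped : well_scoped t.
Hypothesis t_dim : dim t = 1.
Hypothesis G_fv : @fv_below S' (fun=> 2) G.

(* The structure on the whole universe obtained from that of [t] along the
   bijection [G] from the universe to the domain of [t]. *)
Definition pullback : translation S S' :=
  @Translation S S' (fun=> 1) (fun=> @fEq S' tt 0 0) (fun=> @fEq S' tt 0 1)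
    (fun P => @fExs S' tt (rar P)
       (fAnd (fConj [seq appf G [:: rar P + i; i] | i <- iota 0 (rar P)])
             (@trel S S' t P))).

Lemma pullback_scoped : well_scoped pullback.
Proof.
split=> // P; rewrite /= sum_nat_const card_ord muln1; apply: fv_exs.
rewrite fv_and; apply/andP; split; last first.
  apply: fv_below_mono (fv_rel t_scoped t_dim P) => _; exact: leq_addl.
apply: fv_conj => i; rewrite mem_iota /= add0n => hi.
apply: fv_appf; first by rewrite addn_gt0 (leq_ltn_trans _ hi).
by rewrite /= !andbT ltn_add2l hi (leq_trans hi (leq_addl _ _)).
Qed.

Lemma pullback_iso (D : Type) (N : struct S' D) :
  bij (dm N) (dm (internal t_scoped t_dim N)) (defrel N G) ->
  iso (internal pullback_scoped erefl N) (internal t_scoped t_dim N) (defrel N G).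
Proof.
move=> [h1 h2 h3 h4]; split.
  split=> //.
  - by move=> x y hxy; have [hx hy] := h1 _ _ hxy.
  - by move=> x [/h2].
move=> P v w hvw; have hv i : dm N (v i) by have [] := hvw i.
have hw i : dm N (w i) by have [] := hvw i.
rewrite [X in X <-> _]/= sat_exs //; split=> [[f hf]|hP].
  rewrite sat_and sat_conj => -[hG]; apply: iffLR.
  apply: sat_fv (fv_rel t_scoped t_dim P) _ => i hi; rewrite /sprefix hi.
  (* [f i] and [w i] are both images of [v i] under [G], hence equal. *)
  apply/(h4 (v i) _ (v i)) => //; split=> //.
  have := hG i; rewrite mem_iota sat_appf2 // /sprefix hi ltnNge leq_addr /=.
  by rewrite addKn; apply.
exists w => //; rewrite sat_and sat_conj; split.
  move=> i; rewrite mem_iota add0n sat_appf2 // => /= hi.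
  rewrite /sprefix hi ltnNge leq_addr /= addKn.
  by have [] := hvw i.
move: hP; apply: iffLR; apply: sat_fv (fv_rel t_scoped t_dim P) _ => i hi.
by rewrite /sprefix hi.
Qed.

End Pullback.

(** * Internal isomorphisms *)

Lemma nth_map_ord (X : Type) (x0 : X) (f : nat -> X) n i : i < n ->
  nth x0 [seq f j | j : 'I_n <- enum 'I_n] i = f i.
Proof.
by move=> hi; rewrite (nth_map (Ordinal hi)) ?size_enum_ord // nth_enum_ord.
Qed.

(** The clauses of [i_isomorphism] are evaluated at valuations listing the elements concerned, which
    turns provability in [T] into facts about [N]. *)
Lemma i_isomorphism_iso (S S' : rsig) (T : theory S) (K : translation S S')
    (M : translation S' S) (hK : well_scoped K) (hM : well_scoped M)
    (hK1 : dim K = 1) (hM1 : dim M = 1) (F : form S) (D : Type) (N : struct S D) :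
  identity_preserving K -> identity_preserving M ->
  i_isomorphism T (comp_trans M K) (id_trans S) F -> model T N ->
  iso (internal hK hK1 (internal hM hM1 N)) N (defrel N F).
Proof.
move=> hKid hMid; set t := comp_trans M K; pose NM := internal hM hM1 N.
have t1 : dim t = 1 by rewrite /dim /= -/(dim M) hK1 hM1.
case=> hF [hdom _ htot honto [heq hrel]] hN.
have F2 : fv_below (fun=> 2) F by move: hF; rewrite t1.
have domE rho : sat N (dom t) rho <->
    sat N (dom M) (fun=> rho 0) /\ sat NM (dom K) (fun=> rho 0).
  have -> : dom t = fAnd (fConj [seq appf (dom M) (iota (i * dim M) (dim M))
    | i <- iota 0 (dim K)]) (translate M (dom K)) by [].
  rewrite hK1 hM1; have -> : fConj [seq appf (dom M) (iota (i * 1) 1) | i <- iota 0 1]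
    = fAnd (appf (dom M) [:: 0]) fTrue by [].
  rewrite !sat_and.
  rewrite (sat_translate hM hM1 hMid) sat_appf1; last exact: fv_dom.
  rewrite [sat _ fTrue _]/=.
  rewrite (sat_fv NM (rho' := fun=> rho 0) (fv_dom hK hK1)); last by case.
  by split=> [[[? _] ?]|[? ?]].
have dom1 a rho : sat N (appf (dom t) [:: a]) rho <->
    sat N (dom M) (fun=> rho a) /\ sat NM (dom K) (fun=> rho a).
  by rewrite sat_appf domE.
have eqE a b rho : sat N (appf (eqf t) [:: a; b]) rho <-> rho a = rho b.
  by rewrite sat_appf (sat_translate hM hM1 hMid) hKid.
(* The variable tuples have length [dim t], equal to 1 only by [t1]; constant tuples avoid a
   cast. *)
have tup a : tval (nseq_tuple (dim t) a) = [:: a].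
  by rewrite (_ : tval _ = nseq (dim t) a) // t1.
have {}hdom : proves T (fImp (appf F [:: 0; 1])
    (fAnd (appf (dom t) [:: 0]) (appf (dom (id_trans S)) [:: 1]))).
  by have := hdom (nseq_tuple _ 0) [tuple 1]; rewrite !tup.
have {}htot : proves T (fImp (appf (dom t) [:: 0]) (@fEx S tt
    (fAnd (appf (dom (id_trans S)) [:: 0]) (appf F [:: 1; 0])))).
  by have := htot (nseq_tuple _ 0); rewrite !tup.
have {}honto : proves T (fImp (appf (dom (id_trans S)) [:: 0]) (@fEx S tt
    (fAnd (appf (dom t) [:: 0]) (appf F [:: 0; 1])))).
  by have := honto [tuple 0]; rewrite t1.
have {}heq : proves T (fImp (fAnd (appf F [:: 0; 1]) (appf F [:: 2; 3]))
    (fIff (appf (eqf t) [:: 0; 2]) (appf (eqf (id_trans S)) [:: 1; 3]))).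
  have := heq (nseq_tuple _ 0) (nseq_tuple _ 2) [tuple 1] [tuple 3].
  by rewrite !tup.
have {}hrel P : proves T (fImp
    (fConj [seq appf F [:: 2 * i; (2 * i).+1] | i : 'I_(rar P) <- enum 'I_(rar P)])
    (fIff (appf (@trel S S t P) [seq 2 * (i : nat) | i : 'I_(rar P) <- enum 'I_(rar P)])
       (appf (@trel S S (id_trans S) P)
          [seq (2 * i).+1 | i : 'I_(rar P) <- enum 'I_(rar P)]))).
  have := hrel P (fun i => nseq_tuple _ (2 * i)) (fun i => [tuple (2 * i).+1]).
  congr (prv _ (fImp (fConj _) (fIff (appf _ _) (appf _ _)))).
  - by apply: eq_map => i; rewrite tup.
  - by rewrite -[RHS]flatten_map1; congr flatten; apply: eq_map => i; apply: tup.
  - by rewrite -[RHS]flatten_map1.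
have Fe a b rho := sat_appf2 N a b rho F2.
split; first split.
- move=> x y [hx hy hxy].
  have hr : into N (scons x (fun=> y)) by case.
  have := model_imp hN hdom hr; rewrite Fe sat_and dom1 => /(_ hxy) [[h1 h2] _].
  by [].
- move=> x [[hx hM0] hK0].
  have hr : into N (fun=> x) by [].
  have := model_imp hN htot hr; rewrite dom1 sat_ex => -[//|y hy].
  by rewrite sat_and Fe => -[_ hxy]; exists y.
- move=> y hy; have hr : into N (fun=> y) by [].
  have := model_imp hN honto hr; rewrite sat_ex => -[//|x hx].
  by rewrite sat_and Fe => -[_ hxy]; exists x.
- move=> x y x' y' [hx hy hxy] [hx' hy' hxy'].
  have hr : into N (scons x (scons y (scons x' (fun=> y')))) by move=> [|[|[]]].
  have := model_imp hN heq hr; rewrite sat_and !Fe sat_iff eqE sat_appf.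
  by apply.
- move=> P v w hvw.
  (* Even indices carry the arguments [v] and odd ones their images [w], as in [hrel]. *)
  pose rho n := if odd n then w n./2 else v n./2.
  have hr : into N rho by move=> n; rewrite /rho; case: ifP; have [] := hvw n./2.
  have rv i : rho (2 * i) = v i by rewrite /rho mul2n odd_double doubleK.
  have rw i : rho (2 * i).+1 = w i.
    by rewrite /rho mul2n /= odd_double /= uphalf_double.
  have hF' i : i \in enum 'I_(rar P) ->
      sat N (appf F [:: 2 * i; (2 * i).+1]) rho.
    by move=> _; rewrite Fe rv rw; have [] := hvw i.
  have /sat_iff := model_imp hN (hrel P) hr (iffRL (sat_conj _ _ _ _) hF').
  rewrite !sat_appf.
  have -> : sat N (@trel S S t P)
      (fun i => rho (nth 0 [seq 2 * j | j : 'I_(rar P) <- enum 'I_(rar P)] i)) <->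
      rl (internal hK hK1 NM) P v.
    rewrite (sat_translate hM hM1 hMid); apply: sat_fv (fv_rel hK hK1 P) _ => i hi.
    by rewrite (nth_map_ord 0 (muln 2)).
  suff -> : sat N (@trel S S (id_trans S) P)
      (fun i => rho (nth 0 [seq (2 * j).+1 | j : 'I_(rar P) <- enum 'I_(rar P)] i))
      <-> rl N P w by [].
  apply: rl_eq => i hi; rewrite (nth_map_ord 0 id) //.
  by rewrite (nth_map_ord 0 (fun j => (2 * j).+1)).
Qed.

(** * A definable Schroeder-Bernstein theorem *)

(* The usual proof takes for [C] the union of the [f]-chains starting outside
   [q]. The three properties required of [C] do not force the chains to be finite,
   and this is what lets adjunctive classes, without induction, define [C]. *)
Lemma Schroeder_Bernstein (X : Type) (p q q' : X -> Prop) (f : X -> X -> Prop)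
    (C : X -> Prop) :
  (forall x, q x -> p x) -> (forall x, q' x -> q x) -> bij p q' f ->
  (forall x, p x -> ~ q x -> C x) ->
  (forall x y, C x -> f x y -> C y) ->
  (forall y, C y -> q y -> exists2 x, C x & f x y) ->
  bij p q (fun x y => [/\ p x, p y & (C x /\ f x y) \/ (~ C x /\ x = y)]).
Proof.
move=> qp q'q [f1 f2 f3 f4] C1 C2 C3; split.
- move=> x y [px py [[Cx fxy]|[nCx <-]]]; split=> //.
    by apply: q'q; have [] := f1 _ _ fxy.
  by apply: contrapT => nq; apply: nCx; apply: C1.
- move=> x px; have [Cx|nCx] := EM (C x).
    have [y fxy] := f2 _ px; have [_ /q'q/qp py] := f1 _ _ fxy.
    by exists y; split=> //; left.
  by exists x; split=> //; right.
- move=> y qy; have [Cy|nCy] := EM (C y).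
    have [x Cx fxy] := C3 _ Cy qy; have [px _] := f1 _ _ fxy.
    by exists x; split=> //; [apply: qp|left].
  by exists y; split=> //; [apply: qp|apply: qp|right].
- move=> x y x' y' [_ _ h] [_ _ h'].
  case: h h' => [[Cx fxy]|[nCx <-]] [[Cx' fxy']|[nCx' <-]] //.
  + exact: f4.
  (* One point is in [C] and the other is not; neither they nor their images can agree, as [C] is
     closed under [f]. *)
  + split=> E; exfalso; first by apply: nCx'; rewrite -E.
    by apply: nCx'; rewrite -E; apply: C2 fxy.
  + split=> E; exfalso; first by apply: nCx; rewrite E.
    by apply: nCx; rewrite E; apply: C2 fxy'.
Qed.

(** * Adjunctive classes inside a model *)

Section Classes.
Variables (S : rsig) (T : theory S) (I : interp ac T).
Hypothesis I_direct : o_direct I.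

Let c := @tdim ac_sig S I cls.

Lemma fv_cls : @fv_below S (fun=> c) (@tdom ac_sig S I cls).
Proof. by have [h _ _] := interp_scoped I; apply: h. Qed.

Lemma fv_mem : @fv_below S (fun=> c.+1) (@trel ac_sig S I tt).
Proof.
have [_ _ h] := interp_scoped I; have := h tt; congr fv_below.
have [h1 _ _] := I_direct.
by apply/funext => _; rewrite /= !big_ord_recl big_ord0 /= h1 addn0.
Qed.

Variables (D : Type) (N : struct S D).
Hypothesis N_model : model T N.

(** A class is a [c]-tuple, passed as a whole valuation whose first [c] values count. *)
Definition is_class (X : nat -> D) := sat N (@tdom ac_sig S I cls) X.
Definition in_class (x : D) (X : nat -> D) := sat N (@trel ac_sig S I tt) (scons x X).

Lemma sat_mem a k rho : sat N (appf (@trel ac_sig S I tt) (a :: iota k c)) rho <->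
  in_class (rho a) (fun i => rho (k + i)).
Proof.
rewrite sat_appf; apply: sat_fv fv_mem _ => -[|i] //=.
by rewrite ltnS => hi; rewrite nth_iota.
Qed.

Lemma sat_translate_mem e x X a k rho : e obj x = [:: a] -> e cls X = iota k c ->
  sat N (translate_in I e (ac_mem x X)) rho <->
  in_class (rho a) (fun i => rho (k + i)).
Proof.
move=> Ex EX; rewrite /= -sat_mem.
suff -> : flatten [seq e (if val i == 0 then obj else cls) (tnth [tuple x; X] i)
  | i : 'I_2 <- enum 'I_2] = a :: iota k c by [].
by rewrite !enum_ordSl enum_ord0 /= !(tnth_nth 0) /= Ex EX cats0.
Qed.

Lemma in_class_ext x X Y : (forall i, i < c -> X i = Y i) ->
  in_class x X <-> in_class x Y.
Proof. by move=> E; apply: sat_fv fv_mem _ => -[|i] //; rewrite ltnS => /E. Qed.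

Lemma is_class_ext X Y : (forall i, i < c -> X i = Y i) -> is_class X <-> is_class Y.
Proof. exact: sat_fv fv_cls. Qed.

Lemma sprefix_lt (f rho : nat -> D) i : i < c -> sprefix c f rho i = f i.
Proof. by rewrite /sprefix => ->. Qed.

Lemma sprefix_ge (f rho : nat -> D) i : sprefix c f rho (c + i) = rho i.
Proof. by rewrite /sprefix ltnNge leq_addr /= addKn. Qed.

Lemma sat_all_obj e A rho : sat N (translate_in I e (@fAll ac_sig obj A)) rho <->
  (forall x, dm N x -> sat N (translate_in I (up_env I obj e) A) (scons x rho)).
Proof.
have [d1 dom1 _] := I_direct.
have -> : translate_in I e (@fAll ac_sig obj A) = @fAll S tt
  (fImp (@fEq S tt 0 0) (translate_in I (up_env I obj e) A)) by rewrite /= d1 dom1.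
by split=> h x hx; [apply: h|move=> _; apply: h].
Qed.

Lemma sat_all_cls e A rho : into N rho ->
  sat N (translate_in I e (@fAll ac_sig cls A)) rho <->
  (forall X, into N X -> is_class X ->
    sat N (translate_in I (up_env I cls e) A) (sprefix c X rho)).
Proof.
move=> hr; rewrite (_ : translate_in I e _ = @fAlls S tt c
  (fImp (@tdom ac_sig S I cls) (translate_in I (up_env I cls e) A))) //.
rewrite sat_alls //=.
have E X : is_class (sprefix c X rho) <-> is_class X.
  by apply: is_class_ext => i; apply: sprefix_lt.
by split=> h X hX hc; apply: h => //; apply/E.
Qed.

Lemma sat_ex_cls e A rho : into N rho ->
  sat N (translate_in I e (@fEx ac_sig cls A)) rho <->
  (exists X, [/\ into N X, is_class X &
    sat N (translate_in I (up_env I cls e) A) (sprefix c X rho)]).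
Proof.
move=> hr; rewrite (_ : translate_in I e _ =
  fNot (translate_in I e (@fAll ac_sig cls (fNot A)))) //.
rewrite [sat _ (fNot _) _]/= -/(translate_in I e (@fAll ac_sig cls (fNot A))).
rewrite sat_all_cls //; split=> [h|[X [hX hc hA]] h]; last exact: h hA.
by apply: contrapT => n; apply: h => X hX hc hA; apply: n; exists X.
Qed.

Lemma empty_class rho : into N rho ->
  exists X, [/\ into N X, is_class X & forall x, dm N x -> ~ in_class x X].
Proof.
have [d1 _ _] := I_direct.
move=> hr; have pr : proves T (translate I ac_empty).
  by apply: interp_sound; [apply: ac_axioms_sentence; constructor|
    apply: prv_ax; constructor].
have := model_sat N_model pr hr; rewrite /translate sat_ex_cls //.
case=> X [hX hc]; rewrite sat_all_obj => h; exists X; split=> // x hx hxX.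
apply: (h x hx); apply/(@sat_translate_mem _ _ _ 0 1).
- by rewrite /up_env /= d1.
- by rewrite /up_env /= d1 -iotaDl.
- move: hxX; apply: iffRL; apply: in_class_ext => i hi.
  by rewrite /= sprefix_lt.
Qed.

Lemma adjoin_class Y y : into N Y -> is_class Y -> dm N y ->
  exists X, [/\ into N X, is_class X &
    forall x, dm N x -> in_class x X <-> in_class x Y \/ x = y].
Proof.
have [d1 _ eq1] := I_direct.
move=> hY cY hy; have pr : proves T (translate I ac_adjunction).
  by apply: interp_sound; [apply: ac_axioms_sentence; constructor|
    apply: prv_ax; constructor].
have := model_sat N_model pr hY; rewrite /translate sat_all_cls //.
move=> /(_ _ hY cY); rewrite sat_all_obj => /(_ _ hy); rewrite sat_ex_cls; last first.
  by apply: into_scons => //; apply: into_sprefix.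
case=> X [hX hc]; rewrite sat_all_obj => h; exists X; split=> // x hx.
(* [rho] lists [x], the [c] entries of [X], then [y], then those of [Y]; hence the offsets 1 and
   [c.+2]. *)
have := h x hx; set e := up_env I obj _; set rho := scons x _.
rewrite (_ : translate_in I e _ = fIff (translate_in I e (ac_mem 0 0))
  (fOr (translate_in I e (ac_mem 0 1))
       (translate_in I e (@fEq ac_sig obj 0 1)))) //.
rewrite sat_iff sat_or (@sat_translate_mem _ _ _ 0 1); first last.
- by rewrite /e /up_env /= d1 -iotaDl.
- by rewrite /e /up_env /= d1.
rewrite (@sat_translate_mem _ _ _ 0 (c.+2)); first last.
- rewrite /e /up_env /= d1 -/c -!map_comp /=.
  by rewrite -[c.+2]addn0 iotaDl; apply: eq_map => i /=; rewrite !add1n addnS.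
- by rewrite /e /up_env /= d1.
have -> : sat N (translate_in I e (@fEq ac_sig obj 0 1)) rho <-> x = y.
  rewrite /= eq1 sat_appf /= /e /up_env /= d1 /= -/c.
  by rewrite add0n sprefix_ge.
have -> : in_class (rho 0) (fun i => rho (1 + i)) <-> in_class x X.
  by apply: in_class_ext => i hi; rewrite /rho /= sprefix_lt.
have -> // : in_class (rho 0) (fun i => rho (c.+2 + i)) <-> in_class x Y.
by apply: in_class_ext => i hi; rewrite /rho addSn /= addSnnS sprefix_ge /= sprefix_lt.
Qed.

(* The union of the classes in which every element of [Q] has an [f]-preimage. *)
Definition closed_class (Q F : form S) : form S :=
  @fExs S tt c (fAnd (@tdom ac_sig S I cls)
    (fAnd (appf (@trel ac_sig S I tt) (c :: iota 0 c))
      (@fAll S tt (fImp (appf (@trel ac_sig S I tt) (0 :: iota 1 c))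
        (fImp (appf Q [:: 0])
          (@fEx S tt (fAnd (appf (@trel ac_sig S I tt) (0 :: iota 2 c))
            (appf F [:: 1; 0])))))))).

(* The map [f] on [closed_class], the identity elsewhere, where [F x y] says
   [f y = x]. *)
Definition SB_formula (Q F : form S) : form S :=
  fOr (fAnd (appf (closed_class Q F) [:: 0]) (appf F [:: 1; 0]))
      (fAnd (fNot (appf (closed_class Q F) [:: 0])) (@fEq S tt 0 1)).

Lemma fv_SB_formula Q F : fv_below (fun=> 2) (SB_formula Q F).
Proof. by rewrite /= !fv_appf. Qed.

(** The set [C] of [Schroeder_Bernstein] is the union of the good classes, those in which every
    element of [q] has an [f]-preimage. Adjoining single elements suffices to verify its three
    properties. *)
Lemma SB_formula_bij (Q F : form S) (q q' : D -> Prop) :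
  fv_below (fun=> 1) Q -> fv_below (fun=> 2) F ->
  (forall x, q x <-> dm N x /\ sat N Q (fun=> x)) -> (forall x, q' x -> q x) ->
  bij q' (dm N) (defrel N F) ->
  bij (dm N) q (defrel N (SB_formula Q F)).
Proof.
move=> Q1 F2 hq q'q hF.
(* [F] takes [q'] onto the universe; its inverse is the injection to which the theorem is
   applied. *)
pose f x y := defrel N F y x.
pose good X z := in_class z X -> q z -> exists w, [/\ dm N w, in_class w X & f w z].
pose C x := exists X, [/\ into N X, is_class X, in_class x X
  & forall z, dm N z -> good X z].
have CE x rho : dm N x -> into N rho ->
    sat N (appf (closed_class Q F) [:: 0]) (scons x rho) <-> C x.
  move=> hx hr; rewrite sat_appf; set r := fun i => _.
  rewrite sat_exs; last by move=> i; rewrite /r; case: (nth 0 _ i).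
  have cls_ext (X : nat -> D) z : in_class z (sprefix c X r) <-> in_class z X.
    by apply: in_class_ext => i; apply: sprefix_lt.
  have body X : sat N (fAnd (@tdom ac_sig S I cls)
      (fAnd (appf (@trel ac_sig S I tt) (c :: iota 0 c))
        (@fAll S tt (fImp (appf (@trel ac_sig S I tt) (0 :: iota 1 c))
          (fImp (appf Q [:: 0])
            (@fEx S tt (fAnd (appf (@trel ac_sig S I tt) (0 :: iota 2 c))
              (appf F [:: 1; 0])))))))) (sprefix c X r) <->
      [/\ is_class X, in_class x X & forall z, dm N z -> good X z].
    rewrite !sat_and -/(is_class _) (@is_class_ext _ X); last first.
      by move=> i; apply: sprefix_lt.
    have rc : sprefix c X r c = x.
      by rewrite -[X in sprefix _ _ _ X]addn0 sprefix_ge.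
    rewrite sat_mem rc cls_ext.
    have goodE z : dm N z -> sat N (fImp (appf (@trel ac_sig S I tt) (0 :: iota 1 c))
          (fImp (appf Q [:: 0])
            (@fEx S tt (fAnd (appf (@trel ac_sig S I tt) (0 :: iota 2 c))
              (appf F [:: 1; 0]))))) (scons z (sprefix c X r)) <-> good X z.
      move=> hz; rewrite 2!sat_imp sat_appf1 // sat_ex.
      have -> : sat N (appf (@trel ac_sig S I tt) (0 :: iota 1 c))
          (scons z (sprefix c X r)) <-> in_class z X.
        by rewrite sat_mem; apply: cls_ext.
      have mem2 w : sat N (appf (@trel ac_sig S I tt) (0 :: iota 2 c))
          (scons w (scons z (sprefix c X r))) <-> in_class w X.
        by rewrite sat_mem; apply: cls_ext.
      split=> h zX hzq.
        have [|w hw] := h zX; first by case/hq: hzq.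
        by rewrite sat_and mem2 sat_appf2 // => -[wX Fzw]; exists w.
      have [w [hw wX [_ _ Fzw]]] := h zX (iffRL (hq z) (conj hz hzq)).
      by exists w => //; rewrite sat_and mem2 sat_appf2.
    split=> [[h1 [h2 h3]]|[h1 h2 h3]]; split=> //; last split=> //.
      by move=> z hz; apply/goodE => //; apply: h3.
    by move=> z hz; apply/goodE => //; apply: h3.
  split=> [[X hX /body[? ? ?]]|[X [hX ? ? ?]]]; exists X => //.
  by apply/body.
have := @Schroeder_Bernstein D (dm N) q q' f C.
(* The singleton of [x] is good because it contains no element of [q]. *)
have C1 x : dm N x -> ~ q x -> C x.
  move=> hx nq; have [X0 [hX0 cX0 eX0]] := empty_class (fun=> hx).
  have [X [hX cX eX]] := adjoin_class hX0 cX0 hx.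
  exists X; split=> //; first by apply/eX => //; right.
  by move=> z hz /eX[//|/(eX0 _ hz)//|->].
(* Adjoining [y] keeps a class good, as the preimage [x] of [y] is already in it. *)
have C2 x y : C x -> f x y -> C y.
  move=> [X [hX cX xX gX]] fxy; have [hy hx _] := fxy.
  have [Y [hY cY eY]] := adjoin_class hX cX hy.
  exists Y; split=> //; first by apply/eY => //; right.
  move=> z hz /eY[//|zX|->] qz; last by exists x; split=> //; apply/eY => //; left.
  have [w [hw wX fwz]] := gX z hz zX qz.
  by exists w; split=> //; apply/eY => //; left.
have C3 y : C y -> q y -> exists2 x, C x & f x y.
  move=> [X [hX cX yX gX]] qy; have /hq[hy _] := qy.
  have [w [hw wX fwy]] := gX y hy yX qy.
  by exists w => //; exists X.
move/(_ (fun x hx => proj1 (iffLR (hq x) hx)) q'q (bij_sym hF) C1 C2 C3).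
have -> // : (fun x y => [/\ dm N x, dm N y & C x /\ f x y \/ ~ C x /\ x = y]) =
  defrel N (SB_formula Q F).
apply/funext => x; apply/funext => y; apply/propext.
split=> -[hx hy h]; split=> //; move: h; rewrite /SB_formula sat_or !sat_and.
  rewrite sat_imp CE // sat_appf2 // => -[[Cx [_ _ Fyx]]|[nC E]]; first by left.
  by right.
rewrite sat_imp CE // sat_appf2 // => -[[Cx Fyx]|[nC E]]; first by left.
by right.
Qed.

End Classes.

(** * Synonymy *)

Lemma internal_model (S S' : rsig) (U : theory S) (V : theory S') (K : interp U V)
    (hK1 : dim K = 1) (D : Type) (N : struct S' D) :
  identity_preserving K -> model V N ->
  model U (internal (interp_scoped K) hK1 N).
Proof.
move=> hKid hN A rho hA hr; apply/(sat_translate _ _ hKid).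
apply: model_sat hN _ _ => [|i]; last by have [] := hr i.
by apply: interp_sound; [apply: axioms_sentence hA|apply: prv_ax].
Qed.

(** By completeness it is enough that all internal models are models of [U]. *)
Lemma pullback_interp_sound (S S' : rsig) (U : theory S) (V : theory S')
    (t : translation S S') (G : form S') (h : well_scoped (pullback t G)) :
  (forall D (N : struct S' D), model V N -> model U (internal h erefl N)) ->
  forall A, sentence A -> proves U A -> proves V (translate (pullback t G) A).
Proof.
move=> hU A _ hA; apply: completeness => D N rho hN hr.
rewrite (sat_translate h erefl erefl); apply: model_sat (hU _ _ hN) hA _ => i.
by split=> //; apply: hr.
Qed.

(** For domain and identity this is built into [pullback]; for predicates, completeness reduces it
    to models, where [diag] gives the same relations. *)
Lemma pullback_coincide (S S' : rsig) (U : theory S)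
    (t : translation S S') (G : form S') (h : well_scoped (pullback t G))
    (t' : translation S' S) (H : form S) (h' : well_scoped (pullback t' H)) :
  (forall D (N : struct S D), model U N ->
    iso N (internal h erefl (internal h' erefl N)) (diag N)) ->
  coincide U (comp_trans (pullback t' H) (pullback t G)) (id_trans S).
Proof.
move=> hN; split=> //.
- apply: completeness => D N rho _ _; rewrite sat_iff.
  have -> : dom (comp_trans (pullback t' H) (pullback t G)) =
    fAnd (fAnd (@fEq S tt 0 0) fTrue) (@fEq S tt 0 0) by [].
  by rewrite !sat_and; split=> // _; do !split.
- by apply: completeness => D N rho _ _; rewrite sat_iff.
- move=> P; apply: completeness => D N rho mN hr; rewrite sat_iff.
  rewrite (sat_translate h' erefl erefl).
  rewrite -[sat (internal _ _ _) _ _]/(rl (internal h erefl _) P rho).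
  have hd i : diag N (rho i) (rho i) by split.
  rewrite -(iso_rl (hN _ _ mN) P hd).
  by apply: rl_eq => i hi; rewrite (nth_map_ord 0 id).
Qed.

Theorem theorem5p4 (SU SV : rsig) (U : theory SU) (V : theory SV)
  (K : interp U V) (M : interp V U)
  (hV : conceptual V)
  (hKM : bi_interpretation K M)
  (hK1 : dim K = 1) (hM1 : dim M = 1)
  (hKid : identity_preserving K) (hMid : identity_preserving M) :
  synonymous U V.
Proof.
have [I I_direct] := hV; have [[FU hFU] [FV hFV]] := hKM.
pose sK := interp_scoped K; pose sM := interp_scoped M.
have FU2 : fv_below (fun=> 2) FU.
  by have [] := hFU; rewrite /dim /= -!/(dim _) hK1 hM1.
have FV2 : fv_below (fun=> 2) FV.
  by have [] := hFV; rewrite /dim /= -!/(dim _) hK1 hM1.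
pose iK D (N : struct SV D) := internal sK hK1 N.
pose iM D (W : struct SU D) := internal sM hM1 W.
have modK D (N : struct SV D) : model V N -> model U (iK D N).
  exact: internal_model.
have modM D (W : struct SU D) : model U W -> model V (iM D W).
  exact: internal_model.
have isoU D (W : struct SU D) : model U W -> iso (iK D (iM D W)) W (defrel W FU).
  exact: i_isomorphism_iso.
have isoV D (N : struct SV D) : model V N -> iso (iM D (iK D N)) N (defrel N FV).
  exact: i_isomorphism_iso.
(* [FV] maps the universe of [M (K N)], a part of the domain of [K], onto [N]; so [G] will be a
   bijection of [N] with that domain. *)
pose G := SB_formula I (dom K) FV.
have G2 : fv_below (fun=> 2) G := fv_SB_formula I (dom K) FV.
pose K' := pullback K G.
pose sK' : well_scoped K' := pullback_scoped G sK hK1.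
pose iK' D (N : struct SV D) := internal sK' erefl N.
have isoK' D (N : struct SV D) : model V N ->
    iso (iK' D N) (iK D N) (defrel N G).
  move=> mN; apply: (pullback_iso G2).
  apply: (SB_formula_bij I_direct mN (fv_dom sK hK1) FV2) (iso_bij (isoV _ _ mN)) => //.
  by move=> x [].
have modK' D (N : struct SV D) : model V N -> model U (iK' D N).
  by move=> mN; apply: model_iso (iso_sym (isoK' _ _ mN)) (modK _ _ mN).
(* [H x y]: for some [z], [FU] relates [z] to [x], and [G] read in [M W] relates
   [y] to [z]. *)
pose H := fAnd (appf (dom M) [:: 1])
  (@fEx SU tt (fAnd (appf FU [:: 0; 1]) (appf (translate M G) [:: 2; 0]))).
have H2 : fv_below (fun=> 2) H.
  by rewrite /= !fv_appf.
have isoH D (W : struct SU D) : model U W -> iso W (iK' D (iM D W)) (defrel W H).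
  move=> mW; have iU := isoU _ _ mW; have iG := isoK' _ _ (modM _ _ mW).
  apply: iso_ext (iso_sym (iso_comp iG iU)) => x y.
  have satH : sat W H (scons x (fun=> y)) <->
      sat W (dom M) (fun=> y) /\ exists2 z, dm W z &
        sat W FU (scons z (fun=> x)) /\ sat (iM D W) G (scons y (fun=> z)).
    have E z : sat W (fAnd (appf FU [:: 0; 1]) (appf (translate M G) [:: 2; 0]))
        (scons z (scons x (fun=> y))) <->
        sat W FU (scons z (fun=> x)) /\ sat (iM D W) G (scons y (fun=> z)).
      rewrite sat_and sat_appf2 // sat_appf (sat_translate sM hM1 hMid).
      by rewrite (sat_fv _ (rho' := scons y (fun=> z)) G2) //; case=> [|[]].
    rewrite sat_and sat_appf1 ?sat_ex; last exact: fv_dom.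
    by split=> -[h [z hz /E hE]]; split=> //; exists z.
  split=> [[z [[hy Dy] [hz Dz] hG] [_ hx hF]]|[hx hy]].
    by split=> //; apply/satH; split=> //; exists z.
  move/satH => [Dy [z hz [hF hG]]]; exists z => //.
  (* [FU] relates only elements of [K (M W)], so [z] lies in the domain of [M]. *)
  have [[[_ Dz] _] _] := bij_dom (iso_bij iU) (And3 hz hx hF).
  by split.
pose M' := pullback M H.
pose sM' : well_scoped M' := pullback_scoped H sM hM1.
pose iM' D (W : struct SU D) := internal sM' erefl W.
have isoM' D (W : struct SU D) : model U W -> iso (iM' D W) (iM D W) (defrel W H).
  move=> mW; apply: (pullback_iso H2).
  (* The universe of [K' (M W)] is all of [M W], so [H] maps [W] onto the domain of [M]. *)
  have [b1 b2 b3 b4] := iso_bij (isoH _ _ mW); split=> //.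
  - by move=> x y /b1[hx [hy _]].
  - by move=> y hy; apply: b3.
have modM' D (W : struct SU D) : model U W -> model V (iM' D W).
  by move=> mW; apply: model_iso (iso_sym (isoM' _ _ mW)) (modM _ _ mW).
have sameU D (W : struct SU D) : model U W -> iso W (iK' D (iM' D W)) (diag W).
  move=> mW.
  (* [H] is an isomorphism to [K' (M W)] both from [W] and, by applying [K'] to [isoM'], from
     [K' (M' W)]. *)
  apply: iso_cancel (isoH _ _ mW) (internal_iso sK' erefl (isoM' _ _ mW)) _ => x y.
  by split=> [h|[]].
have sameV D (N : struct SV D) : model V N -> iso N (iM' D (iK' D N)) (diag N).
  move=> mN; have mU := modK' _ _ mN.
  (* [R] leads from [M' (K' N)] through [M (K' N)] and [M (K N)] to [N]. *)
  have := iso_comp (iso_comp (isoM' _ _ mU)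
    (internal_iso sM hM1 (isoK' _ _ mN))) (isoV _ _ mN).
  set R := fun x z => _ => iR.
  (* By [sameU], [K' (M' (K' N))] is [K' N], so [R] is an automorphism of [K' N]; applying [M']
     makes it one of [M' (K' N)]. *)
  have iK'R := iso_comp (sameU _ _ mU) (internal_iso sK' erefl iR).
  have iR' : iso (iM' D (iK' D N)) (iM' D (iK' D N)) R.
    apply: iso_ext (internal_iso sM' erefl iK'R) => x y.
    split=> [[[z [<- _] []]]|Rxy] //.
    have [hx _] := bij_dom (iso_bij iR) Rxy.
    by split=> //; exists x => //; split=> //; case: hx.
  exact: iso_cancel (iso_sym iR) (iso_sym iR') _.
exists (Interp sK' (pullback_interp_sound modK')).
exists (Interp sM' (pullback_interp_sound modM')).
by split; apply: pullback_coincide.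
Qed.
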